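(* Let $p,q>1$ be integers. The hypergraph $Q_{pq}^{F}$ has the packing property in each of the following cases: I. $F\subseteq (F_{pq})^{\ast}$ with $F\neq\emptyset$; or II. $F=(E_{pq}\setminus F')^{\ast}$ with $F'\subseteq F_{pq}$ and $F'\neq\emptyset$.
   Context: Let $P=\{p_1,\dots,p_p\}$, $P^{\ast}=\{p_1^{\ast},\dots,p_p^{\ast}\}$, $Q=\{q_1,\dots,q_q\}$, $Q^{\ast}=\{q_1^{\ast},\dots,q_q^{\ast}\}$ and $r,r^{\ast}$ be pairwise distinct elements, and let $V_{pq}=P\cup P^{\ast}\cup Q\cup Q^{\ast}\cup\{r,r^{\ast}\}$. The map $v\mapsto v^{\ast}$ is the involution exchanging $p_i\leftrightarrow p_i^{\ast}$, $q_i\leftrightarrow q_i^{\ast}$, $r\leftrightarrow r^{\ast}$; for $S\subseteq V_{pq}$, $S^{\ast}=\{v^{\ast}:v\in S\}$, and for a family $F$ of subsets, $F^{\ast}=\{f^{\ast}:f\in F\}$. Juxtaposition denotes union, e.g. $XYz=X\cup Y\cup\{z\}$. The hypergraph $Q_{pq}=(V_{pq},E_{pq})$ has as edges exactly the sets $P_1(P\setminus P_1)^{\ast}Qr$ and $(P\setminus P_1)P_1^{\ast}Q^{\ast}r$ for $\emptyset\ne P_1\subseteq P$, and $P(Q\setminus Q_1)Q_1^{\ast}r^{\ast}$ and $P^{\ast}Q_1(Q\setminus Q_1)^{\ast}r^{\ast}$ for $\emptyset\neq Q_1\subseteq Q$. Put $F_{pq}=\{PQr,\ P^{\ast}Q^{\ast}r,\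 PQ^{\ast}r^{\ast},\ P^{\ast}Qr^{\ast}\}\subseteq E_{pq}$, and for $F\subseteq E_{pq}^{\ast}$ let $Q_{pq}^{F}=(V_{pq},E_{pq}\cup F)$. For a hypergraph $H$ and a vertex $i$, the contraction $H/i$ and the deletion $H\backslash i$ have vertex set $V(H)\setminus\{i\}$ and edge sets $E(H/i)=\{S\setminus\{i\}:S\in E(H)\}$ (one may keep only inclusion-minimal members) and $E(H\backslash i)=\{S\in E(H): i\notin S\}$. A minor of $H$ is a hypergraph obtained by a (possibly empty) sequence of deletions and contractions of distinct vertices. $\tau(H)$ is the minimum size of a vertex cover (a set of vertices meeting every edge), and $\nu(H)$ is the maximum number of pairwise disjoint edges. $H$ has the König property (packs) if $\tau(H)=\nu(H)$; by convention, a hypergraph having $\emptyset$ as an edge, or having no edges, packs. $H$ has the packing property if every minor of $H$ (including $H$ itself) has the König property. *)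

(* Defs.v *)
From mathcomp Require Import all_boot.

Set Implicit Arguments.
Unset Strict Implicit.
Unset Printing Implicit Defensive.

Section Hypergraph.
Variable T : finType.

Record hypergraph := Hypergraph {
  vertices : {set T};
  edges : {set {set T}};
  edges_sub : edges \subset powerset vertices
}.

Lemma contraction_sub (H : hypergraph) (i : T) :
  [set S :\ i | S in edges H] \subset powerset (vertices H :\ i).
Proof.
apply/subsetP=> _ /imsetP[S SE ->]; rewrite powersetE setSD //.
by rewrite -powersetE (subsetP (edges_sub H)).
Qed.

Definition contraction (H : hypergraph) (i : T) : hypergraph :=
  Hypergraph (contraction_sub H i).

Lemma deletion_sub (H : hypergraph) (i : T) :
  [set S in edges H | i \notin S] \subset powerset (vertices H :\ i).
Proof.
apply/subsetP=> S; rewrite inE powersetE subsetD1 => /andP[SE ->].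
by rewrite -powersetE (subsetP (edges_sub H)).
Qed.

Definition deletion (H : hypergraph) (i : T) : hypergraph :=
  Hypergraph (deletion_sub H i).

(* The vertices used are automatically distinct, since each one must belong
   to the vertex set of the minor obtained so far. *)
Inductive minor (H : hypergraph) : hypergraph -> Prop :=
| minor_refl : minor H H
| minor_contraction (K : hypergraph) (i : T) :
    minor H K -> i \in vertices K -> minor H (contraction K i)
| minor_deletion (K : hypergraph) (i : T) :
    minor H K -> i \in vertices K -> minor H (deletion K i).

Definition vertex_cover (H : hypergraph) (C : {set T}) : bool :=
  (C \subset vertices H) && [forall S in edges H, S :&: C != set0].

(* If the empty set is an edge, then there is no vertex cover and the value is
   irrelevant (see [packs]); otherwise [vertices H] is a vertex cover. *)
Definition tau (H : hypergraph) : nat :=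
  #|[arg min_(C < vertices H | vertex_cover H C) #|C|]|.

Definition matching (H : hypergraph) (M : {set {set T}}) : bool :=
  (M \subset edges H) && trivIset M.

Definition nu (H : hypergraph) : nat :=
  \max_(M : {set {set T}} | matching H M) #|M|.

Definition packs (H : hypergraph) : Prop :=
  set0 \in edges H \/ edges H = set0 \/ tau H = nu H.

Definition packing_property (H : hypergraph) : Prop :=
  forall K : hypergraph, minor H K -> packs K.

End Hypergraph.

(* [(x, false)] is the vertex [x] and [(x, true)] is its starred copy. *)
Definition vertex (p q : nat) : finType := (('I_p + 'I_q + unit) * bool)%type.

Section Qpq.
Variables p q : nat.
Implicit Types (S : {set vertex p q}) (F : {set {set vertex p q}}).

Definition star (v : vertex p q) : vertex p q := (v.1, ~~ v.2).

Definition star_set S : {set vertex p q} := star @: S.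

Definition star_family F : {set {set vertex p q}} := star_set @: F.

Definition P : {set vertex p q} := [set (inl (inl i), false) | i : 'I_p].
Definition Q : {set vertex p q} := [set (inl (inr j), false) | j : 'I_q].
Definition r : vertex p q := (inr tt, false).

Definition Epq : {set {set vertex p q}} :=
  [set P1 :|: star_set (P :\: P1) :|: Q :|: [set r]
    | P1 in powerset P & P1 != set0]
  :|: [set (P :\: P1) :|: star_set P1 :|: star_set Q :|: [set r]
    | P1 in powerset P & P1 != set0]
  :|: [set P :|: (Q :\: Q1) :|: star_set Q1 :|: [set star r]
    | Q1 in powerset Q & Q1 != set0]
  :|: [set star_set P :|: Q1 :|: star_set (Q :\: Q1) :|: [set star r]
    | Q1 in powerset Q & Q1 != set0].

Definition Fpq : {set {set vertex p q}} :=
  [set P :|: Q :|: [set r];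
       star_set P :|: star_set Q :|: [set r];
       P :|: star_set Q :|: [set star r];
       star_set P :|: Q :|: [set star r]].

Lemma QpqF_sub F : Epq :|: F \subset powerset [set: vertex p q].
Proof. by apply/subsetP=> S _; rewrite powersetE subsetT. Qed.

Definition QpqF F : hypergraph (vertex p q) := Hypergraph (QpqF_sub F).

End Qpq.

(* Main.v *)
Require Import Defs.
From mathcomp Require Import all_boot.

(* Every edge takes exactly one vertex of each pair {v, v*}, so the edges are
   the points (a, b, c) of a subset S of a cube, where a and b are the sets of
   starred indices and c tells r from r*.  Consider a minor with an edge but
   without the empty edge.
   If some pair {v, v*} survives in it, that pair is a cover, so it suffices to
   find two disjoint edges or a one-vertex cover.  Both follow from strict
   polarity: each nonempty restriction of S to a face contains two points that
   agree only in the coordinates on which the whole restriction is constant.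
   Otherwise the minor is a minor of the clutter of differences x \ u, x in S,
   for some point u; it packs trivially if u lies in S.  If u is outside S, the
   minimal differences are pairwise disjoint sets together with sets Y + X,
   where the sets X are disjoint and Y is a fixed set; such a clutter and all
   its minors pack. *)

Set Implicit Arguments.
Unset Strict Implicit.
Unset Printing Implicit Defensive.

(** * Weak duality, a certificate for packing, and the shape of minors *)

Lemma setU1_disjoint (T : finType) (x : T) (A B : {set T}) :
  [disjoint x |: A & B] = (x \notin B) && [disjoint A & B].
Proof. by rewrite !disjoints_subset subUset sub1set inE. Qed.

Section Packing.
Variables (T : finType) (H : hypergraph T).

Lemma edge_subset (e : {set T}) : e \in edges H -> e \subset vertices H.
Proof. by move=> eE; rewrite -powersetE (subsetP (edges_sub H)). Qed.

Lemma vertex_cover_vertices : set0 \notin edges H -> vertex_cover H (vertices H).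
Proof.
move=> nE; rewrite /vertex_cover subxx; apply/forallP=> e; apply/implyP=> eE.
rewrite (setIidPl (edge_subset eE)).
by apply: contraNneq nE => <-.
Qed.

(** Choosing in each member of a matching a vertex of the cover is injective, because the members
    are disjoint. *)
Lemma nu_le_tau : set0 \notin edges H -> nu H <= tau H.
Proof.
move=> nE; rewrite /tau; case: arg_minnP; first exact: vertex_cover_vertices.
move=> B /andP[_ /forallP Bcov] _; apply/bigmax_leqP=> M /andP[ME tM].
pose f (m : {set T}) := [pick v in m :&: B].
have fP m : m \in M -> exists2 v, f m = Some v & v \in m :&: B.
  move=> mM; rewrite /f; case: pickP => [v vP|m0]; first by exists v.
  have /set0Pn[v] := implyP (Bcov m) (subsetP ME m mM).
  by rewrite m0.
have inj : {in M &, injective f}.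
  move=> m m' mM m'M fe; apply: contraTeq isT => mm'.
  have [v fm /setIP[vm _]] := fP m mM; have [w fm' /setIP[wm _]] := fP m' m'M.
  move: fe; rewrite fm fm' => -[vw].
  have /disjointFr := trivIsetP tM m m' mM m'M mm'.
  by move/(_ v vm); rewrite vw wm.
rewrite -(card_in_imset inj) -(card_imset B (@Some_inj _)); apply/subset_leq_card.
apply/subsetP=> _ /imsetP[m mM ->]; have [v -> /setIP[_ vB]] := fP m mM.
exact: imset_f.
Qed.

(** The source of every nontrivial equality [tau H = nu H] below: the disjoint edges [m k] bound
    [nu] from below, the representatives [f k] form a cover and bound [tau] from above, and weak
    duality closes the gap. *)
Lemma packs_of_representatives (K : finType) (A : {set K}) (m : K -> {set T}) (f :
  K -> T) :
    (forall k, k \in A -> m k \in edges H) ->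
    (forall k l v, k \in A -> l \in A -> v \in m k -> v \in m l -> k = l) ->
    (forall k, k \in A -> f k \in m k) ->
    (forall e, e \in edges H -> exists2 k, k \in A & f k \in e) ->
  packs H.
Proof.
move=> mE mdis fm fcov; right; right.
have nE : set0 \notin edges H.
  by apply/negP=> /fcov[k _]; rewrite inE.
apply/eqP; rewrite eqn_leq nu_le_tau // andbT.
have inj : {in A &, injective m}.
  by move=> k l kA lA mkl; apply: (mdis k l (f k)); rewrite ?fm // -mkl fm.
have le1 : tau H <= #|f @: A|.
  rewrite /tau; case: arg_minnP; first exact: vertex_cover_vertices.
  move=> B _; apply; apply/andP; split.
    apply/subsetP=> _ /imsetP[k kA ->].
    exact: subsetP (edge_subset (mE k kA)) _ (fm k kA).
  apply/forallP=> e; apply/implyP=> /fcov[k kA fke].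
  by apply/set0Pn; exists (f k); rewrite inE fke imset_f.
apply: leq_trans le1 _; apply: leq_trans (leq_imset_card _ _) _.
rewrite -(card_in_imset inj).
apply: (bigmax_sup (m @: A)) => //.
apply/andP; split; first by apply/subsetP=> _ /imsetP[k kA ->]; exact: mE.
apply/trivIsetP=> _ _ /imsetP[k kA ->] /imsetP[l lA ->] nkl.
apply/pred0P=> v /=; apply/negP=> /andP[vk vl].
by move: nkl; rewrite (mdis k l v) ?eqxx.
Qed.

(** Operations at distinct vertices commute, so only the set [C] of contracted and the set [D] of
    deleted vertices matter. *)
Lemma minor_edges (L : hypergraph T) : minor H L ->
  exists C D : {set T}, [/\ [disjoint C & D],
    vertices L = vertices H :\: (C :|: D) &
    edges L = [set e :\: C | e in edges H & [disjoint e & D]]].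
Proof.
elim=> [|L' i _ [C [D [CD vL eL]]] iL|L' i _ [C [D [CD vL eL]]] iL].
- exists set0, set0; split; rewrite ?setU0 ?setD0 ?disjoints_subset ?sub0set //.
  apply/setP=> e; apply/idP/imsetP=> [eE|[e']].
    by exists e; rewrite ?setD0 // inE eE disjoints_subset setC0 subsetT.
  by rewrite inE setD0 => /andP[? _] ->.
- exists (i |: C), D; split.
  + rewrite setU1_disjoint CD andbT.
    by move: iL; rewrite vL !inE negb_or -andbA => /and3P[].
  + by rewrite /= vL setDDl; congr (_ :\: _); rewrite setUC setUA.
  rewrite /= eL; apply/setP=> e; apply/imsetP/imsetP.
    move=> [e' /imsetP[e0 e0E ->] ->]; exists e0 => //.
    by rewrite setDDl setUC.
  move=> [e0 e0E ->]; exists (e0 :\: C); first exact: imset_f.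
  by rewrite setDDl setUC.
- move: iL; rewrite vL !inE negb_or -andbA => /and3P[iC iD iH].
  exists C, (i |: D); split.
  + by rewrite disjoint_sym setU1_disjoint iC disjoint_sym.
  + by rewrite /= vL setDDl; congr (_ :\: _); rewrite setUC setUCA.
  rewrite /= eL; apply/setP=> e; rewrite inE; apply/andP/imsetP.
    move=> [/imsetP[e0]]; rewrite inE => /andP[e0E e0D] -> ie; exists e0 => //.
    rewrite inE e0E disjoint_sym setU1_disjoint [[disjoint D & _]]disjoint_sym e0D andbT.
    by move: ie; rewrite !inE iC.
  move=> [e0]; rewrite inE disjoint_sym setU1_disjoint => /andP[e0E /andP[ie e0D]] ->.
  split; last by rewrite !inE (negPf ie) andbF.
  by apply: imset_f; rewrite inE e0E disjoint_sym.
Qed.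

End Packing.

(** * Minors of cuboids: packing from strict polarity and from fans *)

Section Cuboid.
Variables (W X : finType) (coord : X -> W -> bool).

Definition point_edge (x : X) : {set W * bool} := [set v | v.2 == coord x v.1].

Definition differ (x y : X) (w : W) : bool := coord x w != coord y w.

(* Strict polarity of [S], for the restriction to one face. *)
Definition polar (S : pred X) : Prop :=
  exists x y, [/\ S x, S y &
    forall z w, S z -> ~~ differ x y w -> coord z w = coord x w].

(* The minimal differences from [u] are the colour classes in [A] and the unions
   of the class [k0] with a class in [B]; empty classes are allowed. *)
Definition fan (S : pred X) (u : X) : Prop :=
  exists (K : finType) (col : W -> K) (k0 : K) (A B : {set K}),
  [/\ [disjoint A & k0 |: B],
    forall k, k \in A -> exists2 x, S x & forall w, differ u x w = (col w == k),
    forall k, k \in B -> exists2 x, S x &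
      forall w, differ u x w = (col w == k) || (col w == k0) &
    forall x, S x ->
      (exists2 k, k \in A & forall w, col w = k -> differ u x w) \/
      (exists2 k, k \in B & forall w, col w = k \/ col w = k0 -> differ u x w)].

Variable S : pred X.

(** The edge set of the minor that contracts [C] and deletes [D]. *)
Definition trace (C D : {set W * bool}) : {set {set W * bool}} :=
  [set e :\: C | e in [set point_edge x | x in S] & [disjoint e & D]].

Lemma traceP (C D e : {set W * bool}) :
  reflect (exists x, [/\ S x, [disjoint point_edge x & D] & e = point_edge x :\: C])
    (e \in trace C D).
Proof.
apply: (iffP imsetP) => [[e']|[x [Sx xD ->]]].
  by rewrite inE => /andP[/imsetP[x Sx ->] xD] ->; exists x.
by exists (point_edge x); rewrite // inE xD andbT imset_f.
Qed.

Lemma in_point_edgeF (x y : X) (v : W * bool) :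
  v \notin point_edge x -> (v \in point_edge y) = differ x y v.1.
Proof. by rewrite !inE /differ; case: v.2; case: coord; case: coord. Qed.

(** Since [C] contains the edge of [u], an edge of the minor records only where a point differs from
    [u], outside [C]. A class meeting [D] kills the edges that contain it, and a class inside [C]
    becomes empty. *)
Lemma fan_packs (H : hypergraph (W * bool)%type) (C D : {set W * bool}) (u : X) :
    edges H = trace C D -> [disjoint C & D] -> point_edge u \subset C ->
    fan S u -> packs H.
Proof.
move=> HE CD uC [K [col [k0 [A [B [dis hA hB hS]]]]]].
pose cl k := [set v : W * bool | (v \notin point_edge u) && (col v.1 == k)].
have clE k v : (v \in cl k) = (v \notin point_edge u) && (col v.1 == k) by rewrite in_set.
have sub_u v : v \notin C -> v \notin point_edge u by apply/contraNN/(subsetP uC).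
have notCD v : v \in D -> v \notin C by move=> vD; rewrite (disjointFl CD vD).
case: (boolP (set0 \in edges H)) => [|nE]; first by left.
case: (eqVneq (edges H) set0) => [|]; first by right; left.
case/set0Pn=> e0 e0E.
(* [v0] only serves as the default value of the choice [f] below. *)
have [v0 _] : exists v, v \in e0.
  by apply/set0Pn; apply: contraNneq nE => <-.
have memA k : k \in A -> [disjoint cl k & D] -> cl k :\: C \in trace C D.
  move=> /hA[x Sx xk] kD; apply/traceP; exists x; split=> //.
    apply/pred0P=> v /=; apply/negP=> /andP[vx vD].
    have vu := sub_u v (notCD v vD).
    move: vx; rewrite (in_point_edgeF _ vu) xk => vk.
    by move: (disjointFl kD vD); rewrite clE vu vk.
  apply/setP=> v; rewrite !in_setD; case: (boolP (v \in C)) => //= vC.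
  by rewrite (in_point_edgeF _ (sub_u v vC)) xk clE sub_u.
have memB k : k \in B -> [disjoint cl k & D] -> [disjoint cl k0 & D] ->
    (cl k :|: cl k0) :\: C \in trace C D.
  move=> /hB[x Sx xk] kD k0D; apply/traceP; exists x; split=> //.
    apply/pred0P=> v /=; apply/negP=> /andP[vx vD].
    have vu := sub_u v (notCD v vD).
    move: (disjointFl kD vD) (disjointFl k0D vD) vx.
    by rewrite (in_point_edgeF _ vu) xk !clE vu /= => -> ->.
  apply/setP=> v; rewrite !in_setD; case: (boolP (v \in C)) => //= vC.
  by rewrite (in_point_edgeF _ (sub_u v vC)) xk in_setU !clE sub_u.
have meet x k : [disjoint point_edge x & D] ->
    (forall w, col w = k -> differ u x w) ->
    [disjoint cl k & D] /\ cl k \subset point_edge x.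
  move=> xD xk; have sub : cl k \subset point_edge x.
    apply/subsetP=> v; rewrite clE => /andP[vu /eqP vk].
    by rewrite (in_point_edgeF _ vu) xk.
  by split=> //; apply: disjointWl sub xD.
pose f k := if [pick v in cl k :\: C] is Some v then v else v0.
have fP k : cl k :\: C != set0 -> f k \in cl k :\: C.
  rewrite /f; case: pickP => // E0 /set0Pn[v].
  by rewrite E0.
have colf k v : v \in cl k :\: C -> col v.1 = k.
  by rewrite in_setD clE => /and3P[_ _ /eqP].
have fA k : k \in A -> [disjoint cl k & D] -> f k \in cl k :\: C.
  move=> kA kD; apply: fP; apply: contraNneq nE => <-.
  by rewrite HE memA.
have AB k : k \in A -> (k == k0) = false /\ (k \in B) = false.
  by move=> kA; move: (disjointFr dis kA); rewrite !inE => /norP[/negPf-> /negPf->].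
(* If the edges from [B] still share a vertex of class [k0], one of them, [k1], enters the matching
   for all of them, and its representative is taken in class [k0]. *)
case: (boolP [&& [disjoint cl k0 & D], cl k0 :\: C != set0 &
    [exists k in B, [disjoint cl k & D]]]).
  case/and3P=> k0D k0C /existsP[k1 /andP[k1B k1D]].
  pose A1 := k1 |: [set k in A | [disjoint cl k & D]].
  pose m k := if k == k1 then (cl k1 :|: cl k0) :\: C else cl k :\: C.
  pose g k := if k == k1 then f k0 else f k.
  have A1P k : k \in A1 -> k != k1 -> k \in A /\ [disjoint cl k & D].
    by rewrite !inE => /orP[->|/andP[-> ->]].
  (* A vertex of [m k] determines [k], the colours [k0] and [k1] both leading to [k1]; this gives
     disjointness. *)
  have colm k v : k \in A1 -> v \in m k -> k = if col v.1 == k0 then k1 else col v.1.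
    rewrite /m; case: eqVneq => [-> _|kk1 kA1 /colf->].
      rewrite in_setD in_setU !clE => /andP[_ /orP[/andP[_ /eqP->]|/andP[_ ->]]] //.
      by case: ifP.
    by have [/AB[-> _]] := A1P k kA1 kk1.
  apply: (@packs_of_representatives _ _ K A1 m g).
  - move=> k kA1; rewrite HE /m; case: eqVneq => [_|kk1]; first exact: memB.
    by have [] := A1P k kA1 kk1; exact: memA.
  - by move=> k l v kA lA /(colm _ _ kA) -> /(colm _ _ lA).
  - move=> k kA1; rewrite /m /g; case: eqVneq => [_|kk1].
      by move: (fP k0 k0C); rewrite !in_setD in_setU => /andP[-> ->]; rewrite orbT.
    by have [] := A1P k kA1 kk1; exact: fA.
  - move=> _ /[!HE] /traceP[x [Sx xD ->]]; case: (hS x Sx) => [[k kA xk]|[k kB xk]].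
      have [kD kx] := meet x k xD xk.
      exists k; first by rewrite !inE kA kD orbT.
      rewrite /g; case: eqP => [kk1|_]; first by have [_] := AB k kA; rewrite kk1 k1B.
      by apply: subsetP (fA k kA kD); apply: setSD.
    have [_ k0x] := meet x k0 xD (fun w wk => xk w (or_intror wk)).
    exists k1; first by rewrite !inE eqxx.
    by rewrite /g eqxx; apply: subsetP (fP k0 k0C); apply: setSD.
(* Now either no edge from [B] survives, or class [k0] is contracted away and these edges reduce to
   single classes. The surviving classes are disjoint. *)
move=> noB.
pose A1 := [set k | [disjoint cl k & D] && ((k \in A) || (k \in B)
  && [disjoint cl k0 & D])].
have mE k : k \in A1 -> cl k :\: C \in edges H.
  rewrite inE HE => /andP[kD /orP[kA|/andP[kB k0D]]]; first exact: memA.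
  move: noB; rewrite k0D /= negb_and negbK => /orP[/eqP k0C|/existsP[]]; last first.
    by exists k; rewrite kB.
  by move: (memB k kB kD k0D); rewrite setDUl k0C setU0.
have fm k : k \in A1 -> f k \in cl k :\: C.
  by move=> /mE kE; apply: fP; apply: contraNneq nE => <-.
apply: (@packs_of_representatives _ _ K A1 (fun k => cl k :\: C) f) => //.
  by move=> k l v _ _ /colf <- /colf.
move=> _ /[!HE] /traceP[x [Sx xD ->]].
have [k kA1 kx] : exists2 k, k \in A1 & cl k \subset point_edge x.
  case: (hS x Sx) => [[k kA xk]|[k kB xk]].
    by have [kD kx] := meet x k xD xk; exists k; rewrite // inE kD kA.
  have [kD kx] := meet x k xD (fun w wk => xk w (or_introl wk)).
  have [k0D _] := meet x k0 xD (fun w wk => xk w (or_intror wk)).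
  by exists k; rewrite // inE kD kB k0D orbT.
by exists k => //; apply: subsetP (fm k kA1); apply: setSD.
Qed.

(** A vertex outside [C] common to the two polar edges lies in every edge, by polarity, and is a
    cover. Otherwise the two edges are disjoint in the minor, and the pair at [w] is a cover of size
    two. *)
Lemma polar_packs (H : hypergraph (W * bool)%type) (C D : {set W * bool}) (w : W) :
    edges H = trace C D -> (forall t, (w, t) \notin C) ->
    polar (fun x => S x && [disjoint point_edge x & D]) -> packs H.
Proof.
move=> HE wC [x [y [/andP[Sx xD] /andP[Sy yD] xy]]].
have xE : point_edge x :\: C \in edges H by rewrite HE; apply/traceP; exists x.
have yE : point_edge y :\: C \in edges H by rewrite HE; apply/traceP; exists y.
have [v /setDP[vI vC]|no] := pickP (mem (point_edge x :&: point_edge y :\: C)).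
  move: vI; rewrite inE => /andP[vx vy].
  apply: (@packs_of_representatives _ _ unit setT (fun=> point_edge x :\: C) (fun=> v)).
  - by [].
  - by move=> [] [].
  - by rewrite inE vC.
  move=> _ /[!HE] /traceP[z [Sz zD ->]]; exists tt => //.
  rewrite inE vC /= inE (xy z) ?Sz //; first by rewrite !inE in vx.
  by move: vx vy; rewrite !inE /differ => /eqP-> /eqP->; rewrite eqxx.
(* Being disjoint outside [C], the two edges differ at [w]; [z t] is the point whose edge passes
   through [(w, t)]. *)
pose z (t : bool) := if t == coord x w then x else y.
have wz t : (w, t) \in point_edge (z t).
  have := no (w, coord x w); rewrite /= !inE (negPf (wC _)) eqxx /z /=.
  case: (eqVneq t (coord x w)) => [->|] //.
  by case: t; case: (coord x w); case: (coord y w).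
apply: (@packs_of_representatives _ _ bool setT (fun t => point_edge (z t) :\: C)
  (fun t => (w, t))).
- by move=> t _; rewrite /z; case: ifP.
- move=> s t v _ _; have := no v; rewrite /= !in_setD in_setI /z.
  case: (v \in C) => //=.
  by case: s; case: t; case: (coord x w) => //=;
    case: (v \in point_edge x); case: (v \in point_edge y).
- by move=> t _; rewrite inE wC wz.
move=> _ /[!HE] /traceP[a [Sa aD ->]]; exists (coord a w) => //.
by rewrite inE wC inE /=.
Qed.

Hypothesis coord_full : forall h : W -> bool, exists x, coord x =1 h.

Lemma cuboid_packing (H : hypergraph (W * bool)%type) :
    edges H = [set point_edge x | x in S] ->
    (forall D : {set W * bool}, (exists2 x, S x & [disjoint point_edge x & D]) ->
      polar (fun x => S x && [disjoint point_edge x & D])) ->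
    (forall u, ~~ S u -> fan S u) ->
  packing_property H.
Proof.
move=> HE pol fans L /minor_edges[C [D [CD _]]]; rewrite HE => LE.
case: (eqVneq (edges L) set0) => [|/set0Pn[e]]; first by right; left.
rewrite LE => /traceP[x [Sx xD _]].
have [/existsP[w /forallP wC]|] := boolP [exists w, [forall t, (w, t) \notin C]].
  by apply: (polar_packs LE wC); apply: pol; exists x.
rewrite negb_exists => /forallP wC.
(* Every pair now meets [C]; [u] takes a contracted vertex from each, the starred one if
   possible. *)
have [u uE] := coord_full (fun w => (w, true) \in C).
have uC : point_edge u \subset C.
  apply/subsetP=> -[w t]; rewrite inE uE /= => /eqP->.
  move: (wC w); rewrite negb_forall => /existsP[s]; rewrite negbK.
  case: (boolP ((w, true) \in C)) => // wtC.
  by case: s => // wsC; rewrite wsC in wtC.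
have [Su|/fans] := boolP (S u); last exact: (fan_packs LE CD uC).
left; rewrite LE; apply/traceP; exists u; split=> //; first exact: disjointWl uC CD.
by apply/esym/eqP; rewrite setD_eq0.
Qed.

End Cuboid.

(** * Intervals of subsets, their ends and antipodes *)

Section Intervals.
Variable T : finType.
Implicit Types (L U a z : {set T}) (t : bool).

Definition cst t : {set T} := if t then setT else set0.

Definition between L U z := (L \subset z) && (z \subset U).

(** Membership in the smallest interval containing [a] and [a'], that is, agreement with both
    wherever they agree. *)
Definition spans a a' z := between (a :&: a') (a :|: a') z.

(** Indexed by a boolean so that [endpoint L U t] is the end on the side of [cst t]. *)
Definition endpoint L U t := if t then U else L.

Lemma in_cst t i : (i \in cst t) = t.
Proof. by case: t; rewrite !inE. Qed.

Lemma cst_inj : 0 < #|T| -> injective cst.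
Proof. by case/card_gt0P=> i _ s t /setP/(_ i); rewrite !in_cst. Qed.

Lemma cst_neqN s : 0 < #|T| -> cst s != cst (~~ s).
Proof. by move=> T0; apply/negP=> /eqP/(cst_inj T0); case: s. Qed.

Lemma cst_Nneq s : 0 < #|T| -> cst (~~ s) != cst s.
Proof. by rewrite eq_sym; apply: cst_neqN. Qed.

Lemma spansxx a : spans a a a.
Proof. by rewrite /spans setIid setUid /between subxx. Qed.

Definition flip a i : {set T} := [set k | (k \in a) (+) (k == i)].

Lemma flip_neq a i : flip a i != a.
Proof. by apply/eqP=> /setP/(_ i); rewrite !inE eqxx; case: (i \in a). Qed.

Lemma flip_differ a i k : ((k \in a) != (k \in flip a i)) = (k == i).
Proof. by rewrite inE; case: (k \in a); case: (k == i). Qed.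

Lemma neq_differ a a' : a' != a -> exists i, (i \in a) != (i \in a').
Proof.
move=> aa'; apply/existsP; apply: contraR aa'; rewrite negb_exists => /forallP H.
by apply/eqP/setP=> i; have := H i; rewrite negbK => /eqP.
Qed.

Lemma spans_in a a' z i : spans a a' z -> (i \in a) = (i \in a') -> (i \in z) = (i \in a).
Proof.
case/andP=> /subsetP/(_ i) + /subsetP/(_ i) + ia.
rewrite !inE -ia orbb andbb; case: (i \in a) => [-> //|_].
by case: (i \in z) => // ->.
Qed.

Lemma spans_cst t z : spans (cst t) (cst (~~ t)) z.
Proof.
by apply/andP; split; apply/subsetP=> i; rewrite !inE !in_cst ?andbN ?orbN.
Qed.

Lemma spans_endpoints L U z t : between L U z -> spans (endpoint L U t)
  (endpoint L U (~~ t)) z.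
Proof.
case/andP=> /subsetP Lz /subsetP zU; apply/andP; split; apply/subsetP=> i.
  by rewrite inE => /andP[]; case: t => [_ /Lz|/Lz].
by move/zU=> iU; rewrite inE; case: t; rewrite /= iU ?orbT.
Qed.

Lemma between_endpoint L U z t : between L U z -> between L U (endpoint L U t).
Proof. by case/andP=> Lz zU; case: t; rewrite /between subxx (subset_trans Lz). Qed.

Lemma endpoint_cst L U t : between L U (cst t) -> endpoint L U t = cst t.
Proof.
by case: t => /andP[]; rewrite ?subTset ?subset0; [move=> _ /eqP|move/eqP].
Qed.

(** An empty upper end or a full lower end collapses the interval to one set. *)
Lemma endpoint_cstN L U z t s :
  between L U z -> endpoint L U t = cst s -> s = ~~ t -> z = cst s.
Proof.
move=> /andP[Lz zU] e st; move: e; rewrite {}st /cst; case: t => /= e; apply/eqP.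
  by rewrite -subset0 -e.
by rewrite -subTset -e.
Qed.

(** [anti] is the antipode inside the interval, and antipodal sets span it. Removing [e] spoils only
    the pair of [e] and its antipode; if nothing else remains, that antipode is the whole family. *)
Lemma polar_cube L U e (m : bool) z0 :
    between L U z0 -> m || (z0 != e) ->
  exists x y, [/\ between L U x && (m || (x != e)), between L U y && (m || (y != e)) &
    forall z, between L U z -> m || (z != e) -> spans x y z].
Proof.
pose anti z := L :|: (U :\: z).
have antiP z : between L U z -> between L U (anti z).
  case/andP=> Lz zU; rewrite /between subsetUl subUset (subset_trans Lz zU) /=.
  exact: subsetDl.
have antiK z : between L U z -> anti (anti z) = z.
  case/andP=> /subsetP Lz /subsetP zU; apply/setP=> i; rewrite !inE.
  case: (boolP (i \in z)) => [iz|iz]; first by rewrite (zU i iz) !andbT orbF orbN.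
  by rewrite (contraNF (Lz i) iz) andNb.
have spanP z z' : between L U z -> between L U z' -> spans z (anti z) z'.
  move=> /andP[/subsetP Lz /subsetP zU] /andP[/subsetP Lz' /subsetP zU'].
  apply/andP; split; apply/subsetP=> i; rewrite !inE.
    by move=> /andP[iz]; rewrite iz /= orbF => /Lz'.
  by move=> /zU' iU; rewrite iU andbT; case: (i \in z); rewrite ?orbT.
move=> z0P z0e.
case: (boolP (m || (anti z0 != e))) => [az0|].
  by exists z0, (anti z0); rewrite z0P z0e antiP //=; split=> // z zP _; apply: spanP.
rewrite negb_or negbK => /andP[m0 /eqP az0].
case: (boolP [exists z, [&& between L U z, m || (z != e) & z != z0]]).
  case/existsP=> z1 /and3P[z1P z1e z10]; exists z1, (anti z1).
  rewrite z1P z1e antiP //=; split=> // [|z zP _]; last exact: spanP.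
  by rewrite -az0; apply/orP; right; apply: contraNneq z10 => az;
    rewrite -(antiK z0) // -az antiK.
move=> no; exists z0, z0; rewrite z0P z0e; split=> // z zP ze.
suff -> : z = z0 by exact: spansxx.
by apply: contraNeq no => zz0; apply/existsP; exists z; rewrite zP ze.
Qed.

End Intervals.

(** * Points of the cube and its faces *)

Section Points.
Variables I J : finType.

Definition point : finType := ({set I} * {set J} * bool)%type.

Definition coord (x : point) (w : I + J + unit) : bool :=
  match w with
  | inl (inl i) => i \in x.1.1
  | inl (inr j) => j \in x.1.2
  | inr _ => x.2
  end.

Lemma coord_full (h : I + J + unit -> bool) : exists x, coord x =1 h.
Proof.
exists ([set i | h (inl (inl i))], [set j | h (inl (inr j))], h (inr tt)).
by case=> [[i|j]|[]]; rewrite /coord ?inE.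
Qed.

Lemma coord_inj (x y : point) : coord x =1 coord y -> x = y.
Proof.
case: x => [[a b] c]; case: y => [[a' b'] c'] e.
congr (_, _, _); last exact: (e (inr tt)).
  by apply/setP=> i; apply: (e (inl (inl i))).
by apply/setP=> j; apply: (e (inl (inr j))).
Qed.

Lemma polar_intro (S : pred point) (a a' : {set I}) (b b' : {set J}) (c c' : bool) :
    S (a, b, c) -> S (a', b', c') ->
    (forall za zb zc, S (za, zb, zc) ->
      [/\ spans a a' za, spans b b' zb & c = c' -> zc = c]) ->
  polar coord S.
Proof.
move=> Sx Sy sp; exists (a, b, c), (a', b', c'); split=> // -[[za zb] zc] w /sp[sa sb sc].
rewrite negbK; case: w => [[i|j]|[]] /eqP /=; [exact: spans_in|exact: spans_in|].
exact: sc.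
Qed.

Section Face.
Variables (LI UI : {set I}) (LJ UJ : {set J}) (ok : pred bool).

Definition face (x : point) : bool :=
  [&& between LI UI x.1.1, between LJ UJ x.1.2 & ok x.2].

End Face.

(** Deleting [(i, false)] forces [i] into the set and deleting [(i, true)] forces it out, which
    gives the lower and upper bounds. *)
Lemma disjoint_faceP (D : {set (I + J + unit) * bool}) (x : point) :
  [disjoint point_edge coord x & D] =
  face [set i | (inl (inl i), false) \in D] [set i | (inl (inl i), true) \notin D]
       [set j | (inl (inr j), false) \in D] [set j | (inl (inr j), true) \notin D]
       (fun c => (inr tt, c) \notin D) x.
Proof.
case: x => [[a b] c]; apply/pred0P/and3P => [xD|[/andP[/subsetP La /subsetP aU]
  /andP[/subsetP Lb /subsetP bU] cD] [w t]] /=.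
  split; last by apply/negP=> cD; have := xD (inr tt, c); rewrite /= inE eqxx cD.
  - apply/andP; split; apply/subsetP=> i; rewrite inE.
      by apply: contraTT => /negPf ia; have := xD (inl (inl i), false);
        rewrite /= inE /= ia => /= ->.
    by move=> ia; have := xD (inl (inl i), true); rewrite /= inE /= ia => /= ->.
  - apply/andP; split; apply/subsetP=> i; rewrite inE.
      by apply: contraTT => /negPf ia; have := xD (inl (inr i), false);
        rewrite /= inE /= ia => /= ->.
    by move=> ia; have := xD (inl (inr i), true); rewrite /= inE /= ia => /= ->.
rewrite inE /=; apply/negP=> /andP[/eqP-> ]; case: w => [[i|j]|[]] /=; last exact/negP.
  move: (La i) (aU i); rewrite !inE; case: (i \in a) => [_ /(_ isT)/negP //|+ _ wD].
  by move/(_ wD).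
move: (Lb j) (bU j); rewrite !inE; case: (j \in b) => [_ /(_ isT)/negP //|+ _ wD].
by move/(_ wD).
Qed.

End Points.

Arguments coord {I J} x w.

(** * First case: strict polarity and fans *)

Section Cases.
Variables (I J : finType) (kappa : bool -> bool -> bool).
Hypotheses (I0 : 0 < #|I|) (J0 : 0 < #|J|).
Implicit Types (a : {set I}) (b : {set J}) (c : bool).

(* Four cubes, each with one corner removed unless [kappa] retains it. *)
Definition caseI : pred (point I J) := fun x =>
  if x.2 then [exists s, (x.1.1 == cst I s) && ((x.1.2 != cst J s) || kappa s s)]
  else [exists s, (x.1.2 == cst J s) && ((x.1.1 != cst I (~~ s)) || kappa (~~ s) s)].

Lemma caseI_true s b : caseI (cst I s, b, true) = (b != cst J s) || kappa s s.
Proof.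
apply/existsP/idP=> [[t /andP[/eqP/(cst_inj I0)<-]] //|bs].
by exists s; rewrite eqxx.
Qed.

Lemma caseI_false s a : caseI (a, cst J s, false) = (a != cst I (~~ s)) || kappa (~~ s) s.
Proof.
apply/existsP/idP=> [[t /andP[/eqP/(cst_inj J0)<-]] //|bs].
by exists s; rewrite eqxx.
Qed.

Lemma caseI_trueP a b : caseI (a, b, true) -> exists s, a = cst I s.
Proof. by case/existsP=> s /andP[/eqP/= -> _]; exists s. Qed.

Lemma caseI_falseP a b : caseI (a, b, false) -> exists s, b = cst J s.
Proof. by case/existsP=> s /andP[/eqP/= -> _]; exists s. Qed.

Section Polar.
Variables (LI UI : {set I}) (LJ UJ : {set J}) (ok : pred bool).
Let fc := face LI UI LJ UJ ok.
Let eI := endpoint LI UI.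
Let eJ := endpoint LJ UJ.

Lemma polar_caseI_free s t a b :
    (exists s t, kappa s t) ->
    between LI UI (cst I s) -> between LJ UJ (cst J t) -> ok false -> ok true ->
    between LI UI a -> caseI (a, cst J t, false) ->
    between LJ UJ b -> caseI (cst I s, b, true) ->
  polar coord (fun x => caseI x && fc x).
Proof.
move=> kap sI tJ okf okt aI xA bJ yB.
have bI r : between LI UI (eI r) := between_endpoint r aI.
have bJ' r : between LJ UJ (eJ r) := between_endpoint r bJ.
have es : eI s = cst I s := endpoint_cst sI.
have et : eJ t = cst J t := endpoint_cst tJ.
(* Opposite ends of the face agree only in coordinates that the face fixes, so one such pair inside
   [caseI] is enough. *)
have key s' t' : caseI (eI s', eJ t', false) -> caseI (eI (~~ s'), eJ (~~ t'), true) ->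
    polar coord (fun x => caseI x && fc x).
  move=> c1 c2; apply: (polar_intro (a := eI s') (a' := eI (~~ s')) (b := eJ t')
    (b' := eJ (~~ t')) (c := false) (c' := true)).
  - by rewrite c1 /fc /face bI bJ' okf.
  - by rewrite c2 /fc /face bI bJ' okt.
  - by move=> za zb zc /andP[_ /and3P[zI zJ _]]; split=> //; apply: spans_endpoints.
(* When [a] and [b] are unrestricted, of two antipodal ends one is a corner that may be missing. So
   a corner retained by [kappa] is needed; its antipode always belongs to the family. *)
have full : (forall r, eI r = cst I r) -> (forall r, eJ r = cst J r) ->
    polar coord (fun x => caseI x && fc x).
  move=> eIr eJr; case: kap => k [l kl].
  case: (eqVneq k l) => kl'; [subst l|].
    by apply: (key (~~ k) (~~ k)); rewrite !eIr !eJr ?negbK ?caseI_false ?caseI_true ?cst_neqN ?kl ?orbT.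
  have kE : k = ~~ l by case: (k) (l) kl' => [] [].
  by subst k; apply: (key (~~ l) l); rewrite !eIr !eJr ?negbK ?caseI_false ?caseI_true ?cst_Nneq ?kl ?orbT.
have [st|ts] : s = t \/ t = ~~ s by case: (s) (t) => [] []; auto.
  subst t.
  case: (eqVneq (eI (~~ s)) (cst I (~~ s))) => [ens|ens]; last first.
    apply: (key (~~ s) s); first by rewrite et caseI_false ens.
    (* If this end is [cst J s], the interval in [J] collapses to it, and [yB] says that the corner
       is retained. *)
    rewrite negbK es caseI_true; case: eqVneq => //= fb.
    have eb : b = cst J s by apply: (endpoint_cstN bJ fb); rewrite negbK.
    by move: yB; rewrite caseI_true eb eqxx.
  case: (eqVneq (eJ (~~ s)) (cst J (~~ s))) => [fns|fns]; last first.
    apply: (key s s); first by rewrite et es caseI_false cst_neqN.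
    by rewrite ens caseI_true fns.
  by apply: full => r; case: (eqVneq r s) => [->|] //; move: es ens et fns;
    case: (r) (s) => [] [].
subst t; case: (eqVneq (eJ s) (cst J s)) => [fs|fs]; last first.
  apply: (key (~~ s) (~~ s)); rewrite ?negbK ?es ?et ?caseI_true ?fs // caseI_false negbK.
  case: eqVneq => //= e; have ea : a = cst I s by apply: (endpoint_cstN aI e);
    rewrite negbK.
  by move: xA; rewrite ea caseI_false negbK eqxx.
case: (eqVneq (eI (~~ s)) (cst I (~~ s))) => [ens|ens]; last first.
  by apply: (key (~~ s) s); rewrite ?negbK ?es ?et ?fs ?caseI_true ?caseI_false ?ens ?cst_Nneq.
by apply: full => r; case: (eqVneq r s) => [->|] //; move: es ens et fs;
  case: (r) (s) => [] [].
Qed.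

(** The layer [false] consists of two parallel cubes, [b] empty or full, each possibly lacking a
    corner. If the face meets both, opposite ends in [a] work; if it meets one, [polar_cube]
    applies. *)
Lemma polar_caseI_false a b :
    caseI (a, b, false) && fc (a, b, false) ->
    (forall x, caseI x && fc x -> x.2 = false) ->
  polar coord (fun x => caseI x && fc x).
Proof.
move=> /andP[xS /and3P[/= aI bJ okf]] only0.
have [s bs] := caseI_falseP xS; subst b.
have bI r : between LI UI (eI r) := between_endpoint r aI.
(* The corner at risk in the cube [b = cst r] is [cst I (~~ r)], so the end on the side of [r] could
   be missing only if the interval were that single set. *)
have eIs r a' : between LI UI a' -> caseI (a', cst J r, false)
  -> caseI (eI r, cst J r, false).
  move=> aI' c1; rewrite caseI_false; case: eqVneq => //= e.
  by move: c1; rewrite (endpoint_cstN aI' e) // caseI_false eqxx.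
case: (boolP [exists a', caseI (a', cst J (~~ s), false)
  && fc (a', cst J (~~ s), false)]).
  case/existsP=> a' /andP[yS /and3P[/= aI' bJ' _]].
  apply: (polar_intro (a := eI s) (a' := eI (~~ s)) (b := cst J s) (b' := cst J (~~ s))
    (c := false) (c' := false)).
  - by rewrite (eIs s a) // /fc /face bI bJ.
  - by rewrite (eIs (~~ s) a') // /fc /face bI bJ'.
  move=> za zb zc zS; split; [|exact: spans_cst|by have /= -> := only0 _ zS].
  by move: zS => /andP[_ /and3P[zI _ _]]; apply: spans_endpoints.
move=> noN.
have onlys za zb zc : caseI (za, zb, zc) && fc (za, zb, zc) ->
    [/\ zc = false, zb = cst J s, between LI UI za & (kappa (~~ s)
      s || (za != cst I (~~ s)))].
  move=> zS; have /= zc0 := only0 _ zS; subst zc.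
  move: (zS) => /andP[zS' /and3P[zI zJ _]]; have [t zt] := caseI_falseP zS'; subst zb.
  case: (eqVneq t s) => [ts|ts]; first by subst t; rewrite orbC -caseI_false.
  case/negP: noN; apply/existsP; exists za.
  by have <- : t = ~~ s by case: (t) (s) ts => [] [].
have [_ _ _ as'] := onlys a (cst J s) false (introT andP (conj xS (introT and3P (And3 aI bJ okf)))).
have [u [v [/andP[uI us] /andP[vI vs] uv]]] := polar_cube aI as'.
apply: (polar_intro (a := u) (a' := v) (b := cst J s) (b' := cst J s) (c := false) (c' :=
  false)).
- by rewrite caseI_false orbC us /fc /face uI bJ.
- by rewrite caseI_false orbC vs /fc /face vI bJ.
by move=> za zb zc /onlys[-> -> zI zs]; split=> //; [exact: uv|exact: spansxx].
Qed.

(** Mirror image of the layer [false]. The corner at risk in the cube [a = cst r] is now [cst J r],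
    so the safe end lies on the side of [~~ r]. *)
Lemma polar_caseI_true a b :
    caseI (a, b, true) && fc (a, b, true) ->
    (forall x, caseI x && fc x -> x.2 = true) ->
  polar coord (fun x => caseI x && fc x).
Proof.
move=> /andP[xS /and3P[/= aI bJ okt]] only1.
have [s as_] := caseI_trueP xS; subst a.
have bJ' r : between LJ UJ (eJ r) := between_endpoint r bJ.
have eJs r b' : between LJ UJ b' -> caseI (cst I r, b', true)
  -> caseI (cst I r, eJ (~~ r), true).
  move=> bJ1 c1; rewrite caseI_true; case: eqVneq => //= e.
  by move: c1; rewrite (endpoint_cstN bJ1 e) ?negbK // caseI_true eqxx.
case: (boolP [exists b', caseI (cst I (~~ s), b', true) && fc (cst I (~~ s), b', true)]).
  case/existsP=> b' /andP[yS /and3P[/= aI' bJ1 _]].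
  apply: (polar_intro (a := cst I s) (a' := cst I (~~ s)) (b := eJ (~~ s)) (b' :=
    eJ (~~ ~~ s))
    (c := true) (c' := true)).
  - by rewrite (eJs s b) // /fc /face aI bJ'.
  - by rewrite (eJs (~~ s) b') // /fc /face aI' bJ'.
  move=> za zb zc zS; split; [exact: spans_cst| |by have /= -> := only1 _ zS].
  by move: zS => /andP[_ /and3P[_ zJ _]]; apply: spans_endpoints.
move=> noN.
have onlys za zb zc : caseI (za, zb, zc) && fc (za, zb, zc) ->
    [/\ zc = true, za = cst I s, between LJ UJ zb & (kappa s s || (zb != cst J s))].
  move=> zS; have /= zc0 := only1 _ zS; subst zc.
  move: (zS) => /andP[zS' /and3P[zI zJ _]]; have [t zt] := caseI_trueP zS'; subst za.
  case: (eqVneq t s) => [ts|ts]; first by subst t; rewrite orbC -caseI_true.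
  case/negP: noN; apply/existsP; exists zb.
  by have <- : t = ~~ s by case: (t) (s) ts => [] [].
have [_ _ _ bs] := onlys (cst I s) b true (introT andP (conj xS (introT and3P (And3 aI bJ okt)))).
have [u [v [/andP[uJ us] /andP[vJ vs] uv]]] := polar_cube bJ bs.
apply: (polar_intro (a := cst I s) (a' := cst I s) (b := u) (b' := v) (c := true) (c' :=
  true)).
- by rewrite caseI_true orbC us /fc /face uJ aI.
- by rewrite caseI_true orbC vs /fc /face vJ aI.
by move=> za zb zc /onlys[-> -> zJ zs]; split=> //; [exact: spansxx|exact: uv].
Qed.

Lemma polar_caseI x :
    (exists s t, kappa s t) -> caseI x && fc x -> polar coord (fun x => caseI x && fc x).
Proof.
move=> kap xS.
have [y|no0] := pickP [pred y | (caseI y && fc y) && ~~ y.2]; last first.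
  have only1 z : caseI z && fc z -> z.2 = true.
    by move=> zS; have := no0 z; rewrite /= zS /= => /negbFE.
  case: x xS => [[a b] c] xS; have /= c1 := only1 _ xS; subst c.
  exact: polar_caseI_true xS only1.
have [z|no1] := pickP [pred z | (caseI z && fc z) && z.2]; last first.
  have only0 z : caseI z && fc z -> z.2 = false.
    by move=> zS; have := no1 z; rewrite /= zS.
  move=> /andP[yS _]; case: y yS => [[a b] c] yS; have /= c0 := only0 _ yS; subst c.
  exact: polar_caseI_false yS only0.
case: y => [[a b'] c]; case: z => [[a' b] c'] /=.
case: c' => [] /andP[] // zS _; case: c => [] /andP[] // yS _.
move: yS zS => /andP[yS /and3P[aI bJ' okf]] /andP[zS /and3P[aI' bJ okt]].
have [t bt] := caseI_falseP yS; have [s as_] := caseI_trueP zS; subst a' b'.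
exact: (polar_caseI_free kap aI' bJ' okf okt aI yS bJ zS).
Qed.

End Polar.

(* Flipping the coordinates of [I] at which [a] equals [s] turns [a] into
   [cst (~~ s)]; hence the classes given by the values of [a] and [b]. *)
Lemma fan_caseI u : ~~ caseI u -> fan coord caseI u.
Proof.
case: u => [[a b] []] uS.
(* If both points [(cst I s, b, true)] belong to the family, the fan has the two classes of [a]
   alone and each class of [b] joined with the last coordinate [k0]. *)
- have [/forallP allS|] := boolP [forall s, caseI (cst I s, b, true)].
    exists (bool + bool + unit)%type, (fun w => match w with
      | inl (inl i) => inl (inl (i \in a)) | inl (inr j) => inl (inr (j \in b))
        | inr _ => inr tt end),
      (inr tt), [set inl (inl s) | s : bool], [set inl (inr s) | s : bool]; split.
    + apply/pred0P=> k /=; apply/negP=> /andP[/imsetP[s _ ->]].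
      by rewrite !inE /= => /imsetP[].
    + move=> _ /imsetP[s _ ->]; exists (cst I (~~ s), b, true); first exact: allS.
      case=> [[i|j]|[]]; rewrite /differ /= ?in_cst ?eqxx //.
      by case: (i \in a); case: (s).
    + move=> _ /imsetP[s _ ->]; exists (a, cst J (~~ s), false).
        rewrite caseI_false negbK; case: eqVneq => //= as_.
        by move: uS; rewrite as_ (allS s).
      case=> [[i|j]|[]]; rewrite /differ /= ?in_cst ?eqxx //.
      by case: (j \in b); case: (s).
    + move=> [[a' b'] []] xS; [left|right].
        have [s as_] := caseI_trueP xS; subst a'; exists (inl (inl (~~ s)));
          first exact: imset_f.
        case=> [[i|j]|[]] // [] is_; rewrite /differ /= in_cst is_.
        by case: (s).
      have [s bs] := caseI_falseP xS; subst b'; exists (inl (inr (~~ s)));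
        first exact: imset_f.
      by case=> [[i|j]|[]] [] // [] js; rewrite /differ /= in_cst js; case: (s).
  (* Here [b = cst J s] and the corner over [cst I s] is missing, so reaching [cst I s] also costs
     one element [j] of [J]: the class of [a] at [~~ s] becomes the shared part [k0]. *)
  rewrite negb_forall => /existsP[s]; rewrite caseI_true negb_or negbK => /andP[/eqP bs kss].
  subst b.
  exists (bool + J + unit)%type, (fun w => match w with
      | inl (inl i) => inl (inl (i \in a)) | inl (inr j) => inl (inr j)
        | inr _ => inr tt end),
      (inl (inl (~~ s))), [set inl (inl s); inr tt], [set inl (inr j) | j : J]; split.
  + apply/pred0P=> k /=; apply/negP=> /andP[]; rewrite !inE => /orP[] /eqP-> /orP[].
    * by case: (s).
    * by case/imsetP.
    * by [].
    * by case/imsetP.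
  + move=> k; rewrite !inE => /orP[] /eqP->.
      exists (cst I (~~ s), cst J s, true); first by rewrite caseI_true cst_neqN.
      case=> [[i|j]|[]]; rewrite /differ /= ?in_cst ?eqxx //.
      by case: (i \in a); case: (s).
    exists (a, cst J s, false).
      rewrite caseI_false; case: eqVneq => //= as_.
      by move: uS; rewrite as_ caseI_true cst_neqN.
    by case=> [[i|j]|[]]; rewrite /differ /= ?in_cst ?eqxx.
  + move=> _ /imsetP[j _ ->]; exists (cst I s, flip (cst J s) j, true).
      by rewrite caseI_true flip_neq.
    case=> [[i|j']|[]]; rewrite /differ /= ?flip_differ ?orbF // in_cst.
    by case: (i \in a); case: (s).
  + move=> [[a' b'] []] xS; last first.
      by left; exists (inr tt); [rewrite !inE eqxx orbT|case=> [[i|j]|[]]].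
    have [t at_] := caseI_trueP xS; subst a'; case: (eqVneq t s) => ts; last first.
      left; exists (inl (inl s)); first by rewrite !inE eqxx.
      case=> [[i|j]|[]] // [] is_; rewrite /differ /= in_cst is_.
      by rewrite eq_sym.
    subst t; right; move: xS; rewrite caseI_true (negPf kss) orbF => /neq_differ[j bj].
    exists (inl (inr j)); first exact: imset_f.
    case=> [[i|j']|[]] [] // []; first by move=> is_; rewrite /differ /= in_cst is_;
      case: (s).
    by move=> ->.
(* The layer [false] is analogous, with [I] and [J] exchanged. *)
- have [/forallP allS|] := boolP [forall s, caseI (a, cst J s, false)].
    exists (bool + bool + unit)%type, (fun w => match w with
      | inl (inl i) => inl (inl (i \in a)) | inl (inr j) => inl (inr (j \in b))
        | inr _ => inr tt end),
      (inr tt), [set inl (inr s) | s : bool], [set inl (inl s) | s : bool]; split.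
    + apply/pred0P=> k /=; apply/negP=> /andP[/imsetP[s _ ->]].
      by rewrite !inE /= => /imsetP[].
    + move=> _ /imsetP[s _ ->]; exists (a, cst J (~~ s), false); first exact: allS.
      case=> [[i|j]|[]]; rewrite /differ /= ?in_cst ?eqxx //.
      by case: (j \in b); case: (s).
    + move=> _ /imsetP[s _ ->]; exists (cst I (~~ s), b, true).
        rewrite caseI_true; case: eqVneq => //= bs.
        by move: uS; rewrite bs (allS (~~ s)).
      case=> [[i|j]|[]]; rewrite /differ /= ?in_cst ?eqxx //.
      by case: (i \in a); case: (s).
    + move=> [[a' b'] []] xS; [right|left].
        have [s as_] := caseI_trueP xS; subst a'; exists (inl (inl (~~ s)));
          first exact: imset_f.
        by case=> [[i|j]|[]] [] // [] is_; rewrite /differ /= in_cst is_; case: (s).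
      have [s bs] := caseI_falseP xS; subst b'; exists (inl (inr (~~ s)));
        first exact: imset_f.
      case=> [[i|j]|[]] // [] js; rewrite /differ /= in_cst js.
      by case: (s).
  rewrite negb_forall => /existsP[s]; rewrite caseI_false negb_or negbK => /andP[/eqP as_ kss].
  subst a.
  exists (I + bool + unit)%type, (fun w => match w with
      | inl (inl i) => inl (inl i) | inl (inr j) => inl (inr (j \in b))
        | inr _ => inr tt end),
      (inl (inr (~~ s))), [set inl (inr s); inr tt], [set inl (inl i) | i : I]; split.
  + apply/pred0P=> k /=; apply/negP=> /andP[]; rewrite !inE => /orP[] /eqP-> /orP[].
    * by case: (s).
    * by case/imsetP.
    * by [].
    * by case/imsetP.
  + move=> k; rewrite !inE => /orP[] /eqP->.
      exists (cst I (~~ s), cst J (~~ s), false); first by rewrite caseI_false cst_neqN.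
      case=> [[i|j]|[]]; rewrite /differ /= ?in_cst ?eqxx //.
      by case: (j \in b); case: (s).
    exists (cst I (~~ s), b, true).
      rewrite caseI_true; case: eqVneq => //= bs.
      by move: uS; rewrite bs caseI_false cst_neqN.
    by case=> [[i|j]|[]]; rewrite /differ /= ?in_cst ?eqxx.
  + move=> _ /imsetP[i _ ->]; exists (flip (cst I (~~ s)) i, cst J s, false).
      by rewrite caseI_false flip_neq.
    case=> [[i'|j]|[]]; rewrite /differ /= ?flip_differ ?orbF // in_cst.
    by case: (j \in b); case: (s).
  + move=> [[a' b'] []] xS.
      by left; exists (inr tt); [rewrite !inE eqxx orbT|case=> [[i|j]|[]]].
    have [t bt] := caseI_falseP xS; subst b'; case: (eqVneq t s) => ts; last first.
      left; exists (inl (inr s)); first by rewrite !inE eqxx.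
      case=> [[i|j]|[]] // [] js; rewrite /differ /= in_cst js.
      by rewrite eq_sym.
    subst t; right; move: xS; rewrite caseI_false (negPf kss) orbF => /neq_differ[i ai].
    exists (inl (inl i)); first exact: imset_f.
    case=> [[i'|j]|[]] [] // []; last by move=> js; rewrite /differ /= in_cst js;
      case: (s).
    by move=> ->.
Qed.

End Cases.

(** * Second case: strict polarity and fans *)

Section CaseII.
Variables (I J : finType) (kappa : bool -> bool -> bool).
Hypotheses (I0 : 0 < #|I|) (J0 : 0 < #|J|) (J1 : 1 < #|J|).
Implicit Types (a : {set I}) (b : {set J}) (c : bool).

(* All points with [a] or [b] constant, except the points (cst s, cst t, s == t)
   rejected by [kappa]. *)
Definition caseII : pred (point I J) := fun x =>
  [exists s, (x.1.1 == cst I s) && ((x.1.2 != cst J (s == x.2)) || kappa s (s == x.2))] ||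
  [exists t, (x.1.2 == cst J t) && ((x.1.1 != cst I (t == x.2)) || kappa (t == x.2) t)].

(** Boolean equality is its own inverse, so the corner condition [c = (s == t)] can be solved as
    [t = (s == c)] or [s = (t == c)]; [caseII] uses both forms. *)
Lemma eqbK (s c : bool) : ((s == c) == c) = s.
Proof. by case: s; case: c. Qed.

Lemma caseII_l s b c : caseII (cst I s, b, c) = (b != cst J (s == c)) || kappa s (s == c).
Proof.
apply/orP/idP=> [[|]|H]; last first.
- by left; apply/existsP; exists s; rewrite eqxx.
- case/existsP=> t /andP[/eqP/= ->]; case: (eqVneq t (s == c)) => [->|ts _].
    by rewrite eqbK eqxx /= => ->; rewrite orbT.
  by apply/orP; left; apply: contra ts => /eqP/(cst_inj J0)/eqP.
by case/existsP=> t /andP[/eqP/(cst_inj I0)<-].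
Qed.

Lemma caseII_r a t c : caseII (a, cst J t, c) = (a != cst I (t == c)) || kappa (t == c) t.
Proof.
apply/orP/idP=> [[|]|H]; last first.
- by right; apply/existsP; exists t; rewrite eqxx.
- by case/existsP=> s /andP[/eqP/(cst_inj J0)<-].
case/existsP=> s /andP[/eqP/= ->]; case: (eqVneq s (t == c)) => [->|ts _].
  by rewrite eqbK eqxx /= => ->; rewrite orbT.
by apply/orP; left; apply: contra ts => /eqP/(cst_inj I0)/eqP.
Qed.

Lemma caseII_cst a b c : caseII (a, b, c) -> (exists s, a = cst I s)
  \/ (exists t, b = cst J t).
Proof.
by case/orP=> /existsP[s /andP[/eqP/= -> _]]; [left|right]; exists s.
Qed.

Section Polar.
Variables (LI UI : {set I}) (LJ UJ : {set J}) (ok : pred bool).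
Let fc := face LI UI LJ UJ ok.
Let eI := endpoint LI UI.
Let eJ := endpoint LJ UJ.
Let S := fun x => caseII x && fc x.

(** Without a constant [a] the face reaches no corner, so the family there is a full product of the
    values of [a], the constant [b] and the admissible [c]. Opposite values are taken in each
    factor, [t'] and [c'] being flipped when the face allows it. *)
Lemma polar_caseII_no_cst_l a b c :
    S (a, b, c) -> (forall s, ~~ between LI UI (cst I s)) -> polar coord S.
Proof.
move=> /andP[xS /and3P[/= aI bJ okc]] nocst.
have bI r : between LI UI (eI r) := between_endpoint r aI.
have ncst z s : between LI UI z -> z != cst I s.
  by move=> zI; apply: contraNneq (nocst s) => <-.
have [[s as_]|[t bt]] := caseII_cst xS; first by have := ncst a s aI; rewrite as_ eqxx.
subst b; pose t' := if between LJ UJ (cst J (~~ t)) then ~~ t else t.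
pose c' := if ok (~~ c) then ~~ c else c.
have tJ' : between LJ UJ (cst J t') by rewrite /t'; case: ifP.
have okc' : ok c' by rewrite /c'; case: ifP.
apply: (polar_intro (a := eI true) (a' := eI false) (b := cst J t) (b' := cst J t') (c :=
  c) (c' := c')).
- by rewrite /S caseII_r (ncst _ _ (bI _)) /fc /face bI /= bJ okc.
- by rewrite /S caseII_r (ncst _ _ (bI _)) /fc /face bI /= tJ' okc'.
move=> za zb zc /andP[zS /and3P[/= zI zJ okz]]; split;
  first exact: (spans_endpoints true zI).
  have [[s zs]|[r zr]] := caseII_cst zS; first by have := ncst za s zI; rewrite zs eqxx.
  subst zb; rewrite /t'; case: ifP => tn; first exact: spans_cst.
  suff -> : r = t by exact: spansxx.
  by apply: contraFeq tn => rt; have <- : r = ~~ t by case: (r) (t) rt => [] [].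
by rewrite /c'; case: ifP; move: okz; case: (zc) (c) => [] [] // ->.
Qed.

Lemma polar_caseII_no_cst_r a b c :
    S (a, b, c) -> (forall s, ~~ between LJ UJ (cst J s)) -> polar coord S.
Proof.
move=> /andP[xS /and3P[/= aI bJ okc]] nocst.
have bJ' r : between LJ UJ (eJ r) := between_endpoint r bJ.
have ncst z s : between LJ UJ z -> z != cst J s.
  by move=> zI; apply: contraNneq (nocst s) => <-.
have [[t at_]|[s bs]] := caseII_cst xS; last by have := ncst b s bJ; rewrite bs eqxx.
subst a; pose t' := if between LI UI (cst I (~~ t)) then ~~ t else t.
pose c' := if ok (~~ c) then ~~ c else c.
have tI' : between LI UI (cst I t') by rewrite /t'; case: ifP.
have okc' : ok c' by rewrite /c'; case: ifP.
apply: (polar_intro (a := cst I t) (a' := cst I t') (b := eJ true) (b' := eJ false) (c :=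
  c) (c' := c')).
- by rewrite /S caseII_l (ncst _ _ (bJ' _)) /fc /face bJ' /= aI okc.
- by rewrite /S caseII_l (ncst _ _ (bJ' _)) /fc /face bJ' /= tI' okc'.
move=> za zb zc /andP[zS /and3P[/= zI zJ okz]]; split;
  [|exact: (spans_endpoints true zJ)|].
  have [[r zr]|[s zs]] := caseII_cst zS; last by have := ncst zb s zJ; rewrite zs eqxx.
  subst za; rewrite /t'; case: ifP => tn; first exact: spans_cst.
  suff -> : r = t by exact: spansxx.
  by apply: contraFeq tn => rt; have <- : r = ~~ t by case: (r) (t) rt => [] [].
by rewrite /c'; case: ifP; move: okz; case: (zc) (c) => [] [] // ->.
Qed.

Lemma polar_caseII_layer s t a b c :
    between LI UI (cst I s) -> between LJ UJ (cst J t) ->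
    S (a, b, c) -> (forall x, S x -> x.2 = c) ->
  polar coord S.
Proof.
move=> sI tJ xS onlyc; move: (xS) => /andP[xS' /and3P[/= aI bJ okc]].
have bI r : between LI UI (eI r) := between_endpoint r aI.
have bJ' r : between LJ UJ (eJ r) := between_endpoint r bJ.
have es : eI s = cst I s := endpoint_cst sI.
have et : eJ t = cst J t := endpoint_cst tJ.
have key s' t' : caseII (eI s', eJ t', c) -> caseII (eI (~~ s'), eJ (~~ t'), c)
  -> polar coord S.
  move=> c1 c2; apply: (polar_intro (a := eI s') (a' := eI (~~ s')) (b := eJ t')
    (b' := eJ (~~ t')) (c := c) (c' := c)).
  - by rewrite /S c1 /fc /face bI bJ' okc.
  - by rewrite /S c2 /fc /face bI bJ' okc.
  move=> za zb zc zS; have /= -> := onlyc _ zS.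
  by move: zS => /andP[_ /and3P[zI zJ _]]; split=> //; apply: spans_endpoints.
case: (eqVneq (eI (~~ s)) (cst I s)) => [e|fa].
  have as_ z : between LI UI z -> z = cst I s.
    by move=> zI; apply: (endpoint_cstN zI e); rewrite negbK.
  have zP zb : caseII (cst I s, zb, c) = kappa s (s == c) || (zb != cst J (s == c)).
    by rewrite caseII_l orbC.
  move: xS'; rewrite (as_ a aI) zP => bP.
  have [u [v [/andP[uJ us] /andP[vJ vs] uv]]] := polar_cube bJ bP.
  apply: (polar_intro (a := cst I s) (a' := cst I s) (b := u) (b' := v) (c := c) (c' :=
    c)).
  - by rewrite /S zP us /fc /face uJ /= sI okc.
  - by rewrite /S zP vs /fc /face vJ /= sI okc.
  move=> za zb zc zS; have /= zcc := onlyc _ zS; subst zc.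
  move: zS => /andP[zS /and3P[/= zI zJ _]]; move: zS; rewrite (as_ za zI) zP => zS.
  by split=> //; [exact: spansxx|exact: uv].
case: (eqVneq (eJ (~~ t)) (cst J t)) => [e|fb].
  have bt z : between LJ UJ z -> z = cst J t.
    by move=> zJ; apply: (endpoint_cstN zJ e); rewrite negbK.
  have zP za : caseII (za, cst J t, c) = kappa (t == c) t || (za != cst I (t == c)).
    by rewrite caseII_r orbC.
  move: xS'; rewrite (bt b bJ) zP => aP.
  have [u [v [/andP[uI us] /andP[vI vs] uv]]] := polar_cube aI aP.
  apply: (polar_intro (a := u) (a' := v) (b := cst J t) (b' := cst J t) (c := c) (c' :=
    c)).
  - by rewrite /S zP us /fc /face uI /= tJ okc.
  - by rewrite /S zP vs /fc /face vI /= tJ okc.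
  move=> za zb zc zS; have /= zcc := onlyc _ zS; subst zc.
  move: zS => /andP[zS /and3P[/= zI zJ _]]; move: zS; rewrite (bt zb zJ) zP => zS.
  by split=> //; [exact: uv|exact: spansxx].
(* If [c = (s == t)], the corners at risk are [(s, t)] and its opposite, and the other diagonal of
   the face is used. Otherwise they are [(~~ s, t)] and [(s, ~~ t)], and the diagonal depends on
   whether the far ends are constant. *)
have [cE|cE] : c = (s == t) \/ c = (s != t) by case: (c) (s == t) => [] []; auto.
  have tc : (t == c) = s by rewrite cE; case: (s) (t) => [] [].
  have sc : (s == c) = t by rewrite cE; case: (s) (t) => [] [].
  by apply: (key (~~ s) t); rewrite ?negbK ?es ?et ?caseII_l ?caseII_r ?tc ?sc ?fa ?fb.
have tc : (t == c) = ~~ s by rewrite cE; case: (s) (t) => [] [].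
have sc : (s == c) = ~~ t by rewrite cE; case: (s) (t) => [] [].
have ntc : (~~ t == c) = s by rewrite cE; case: (s) (t) => [] [].
have nsc : (~~ s == c) = t by rewrite cE; case: (s) (t) => [] [].
case: (eqVneq (eI (~~ s)) (cst I (~~ s))) => [e|fa'].
  by apply: (key s t); rewrite ?es ?et ?e ?caseII_l ?sc ?nsc ?fb ?cst_neqN.
case: (eqVneq (eJ (~~ t)) (cst J (~~ t))) => [e|fb'].
  by apply: (key s t); rewrite ?es ?et ?e ?caseII_r ?tc ?ntc ?fa ?cst_neqN.
by apply: (key (~~ s) t); rewrite ?negbK ?es ?et ?caseII_l ?caseII_r ?tc ?sc ?fa' ?fb'.
Qed.

Lemma polar_caseII_free s t (a a' : {set I}) (b b' : {set J}) :
    between LI UI (cst I s) -> between LJ UJ (cst J t) ->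
    S (a, b, false) -> S (a', b', true) ->
  polar coord S.
Proof.
move=> sI tJ xS yS; move: (xS) (yS) => /andP[xS' /and3P[/=
  aI bJ okf]] /andP[yS' /and3P[/= _ _ okt]].
have okc c : ok c by case: c.
have bI r : between LI UI (eI r) := between_endpoint r aI.
have bJ' r : between LJ UJ (eJ r) := between_endpoint r bJ.
have es : eI s = cst I s := endpoint_cst sI.
have et : eJ t = cst J t := endpoint_cst tJ.
(* The value of [c] decides what to avoid: [cst I s] and [cst J (~~ t)] as far ends if
   [c = (s == t)], but [cst I (~~ s)] and [cst J t] for the other value. *)
have key c : caseII (eI (~~ s), cst J t, c) -> caseII (cst I s, eJ (~~ t), ~~ c)
  -> polar coord S.
  rewrite -es -et => c1 c2; apply: (polar_intro (a := eI (~~ s)) (a' := eI s) (b := eJ t)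
    (b' := eJ (~~ t)) (c := c) (c' := ~~ c)).
  - by rewrite /S c1 /fc /face bI bJ' okc.
  - by rewrite /S c2 /fc /face bI bJ' okc.
  move=> za zb zc /andP[_ /and3P[zI zJ _]]; split; last by case: (c).
    by rewrite -{2}[s]negbK; apply: spans_endpoints.
  exact: spans_endpoints.
have e1 : (t == (s == t)) = s by case: (s) (t) => [] [].
have e2 : (s == ~~ (s == t)) = ~~ t by case: (s) (t) => [] [].
have e3 : (t == ~~ (s == t)) = ~~ s by case: (s) (t) => [] [].
have e4 : (s == ~~ ~~ (s == t)) = t by case: (s) (t) => [] [].
case: (eqVneq (eI (~~ s)) (cst I s)) => [e|fa].
  case: (eqVneq (eJ (~~ t)) (cst J t)) => [f|fb].
    have as_ z : between LI UI z -> z = cst I s.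
      by move=> zI; apply: (endpoint_cstN zI e); rewrite negbK.
    have bt z : between LJ UJ z -> z = cst J t.
      by move=> zJ; apply: (endpoint_cstN zJ f); rewrite negbK.
    apply: (polar_intro xS yS) => za zb zc /andP[_ /and3P[/= /as_-> /bt-> _]].
    move: yS => /andP[_ /and3P[/= /as_-> /bt-> _]].
    by rewrite (as_ _ aI) (bt _ bJ); split=> //; exact: spansxx.
  by apply: (key (~~ (s == t))); rewrite ?caseII_r ?caseII_l ?e3 ?e4 ?fb // e cst_neqN.
case: (eqVneq (eJ (~~ t)) (cst J (~~ t))) => [f|fb]; last first.
  by apply: (key (s == t)); rewrite ?caseII_r ?caseII_l ?e1 ?e2 ?fa ?fb.
case: (eqVneq (eI (~~ s)) (cst I (~~ s))) => [e|fa']; last first.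
  by apply: (key (~~ (s == t))); rewrite ?caseII_r ?caseII_l ?e3 ?e4 ?fa' // f cst_Nneq.
have allI z : between LI UI z.
  suff [-> ->] : LI = set0 /\ UI = setT by rewrite /between sub0set subsetT.
  by move: es e; rewrite /eI; case: (s) => /= -> ->.
have allJ z : between LJ UJ z.
  suff [-> ->] : LJ = set0 /\ UJ = setT by rewrite /between sub0set subsetT.
  by move: et f; rewrite /eJ; case: (t) => /= -> ->.
(* Now [a] and [b] are unrestricted, and of two antipodal points with both entries constant one may
   be missing. A singleton and its complement replace the constant [b]; neither is constant, as [J]
   has two elements. *)
have /card_gt0P[j0 _] := J0.
have j0c r : [set j0] != cst J r.
  case: r => /=; apply/eqP=> /(congr1 (fun B : {set J} => #|B|)).
    by rewrite cards1 cardsT => e1'; move: J1; rewrite -e1'.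
  by rewrite cards1 cards0.
have j0c' r : ~: [set j0] != cst J r.
  apply: contra (j0c (~~ r)) => /eqP e0; rewrite -[[set j0]]setCK e0.
  by case: (r); rewrite /= ?setCT ?setC0.
apply: (polar_intro (a := cst I s) (a' := cst I (~~ s)) (b := [set j0]) (b' := ~:
  [set j0])
  (c := false) (c' := true)).
- by rewrite /S caseII_l j0c /fc /face allI allJ okc.
- by rewrite /S caseII_l j0c' /fc /face allI allJ okc.
move=> za zb zc _; split=> //; first exact: spans_cst.
by rewrite /spans /between setICr setUCr sub0set subsetT.
Qed.

Lemma polar_caseII x : S x -> polar coord S.
Proof.
case: x => [[a b] c] xS.
have [/existsP[s sI]|noI] := boolP [exists s, between LI UI (cst I s)]; last first.
  by apply: (polar_caseII_no_cst_l xS) => s; apply: contra noI => H; apply/existsP;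
    exists s.
have [/existsP[t tJ]|noJ] := boolP [exists t, between LJ UJ (cst J t)]; last first.
  by apply: (polar_caseII_no_cst_r xS) => t; apply: contra noJ => H; apply/existsP;
    exists t.
have [[[a' b'] c'] /andP[/= yS yc]|no] := pickP [pred y | S y && (y.2 != c)].
  by case: c c' xS yS yc => [] [] // xS yS _; apply: (polar_caseII_free sI tJ);
    eassumption.
apply: (polar_caseII_layer sI tJ xS) => z zS.
by have := no z; rewrite /= zS /= => /negbFE/eqP.
Qed.

End Polar.

(** Flipping any one coordinate of a rejected corner gives a member, so singletons form the fan. Any
    other [u] outside the family has no constant entry, and it suffices to make [a] or [b] constant,
    whatever [c] is. *)
Lemma fan_caseII u : ~~ caseII u -> fan coord caseII u.
Proof.
move=> uS; have [/existsP[[s t] /eqP uE]|noc] :=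
  boolP [exists st, u == (cst I st.1, cst J st.2, st.1 == st.2)].
  have tc : (t == (s == t)) = s by case: (s) (t) => [] [].
  have sc : (s == (s == t)) = t by case: (s) (t) => [] [].
  have sNc : (s == ~~ (s == t)) = ~~ t by case: (s) (t) => [] [].
  (* [None] is a dummy for [k0], since [B] is empty. *)
  exists (option (I + J + unit)), some, None, [set some w | w : I + J + unit], set0;
    split.
  + by apply/pred0P=> k /=; apply/negP=> /andP[/imsetP[w _ ->]]; rewrite !inE.
  + move=> _ /imsetP[k _ ->]; rewrite uE /=; case: k => [[i|j]|[]].
    * exists (flip (cst I s) i, cst J t, s == t); first by rewrite caseII_r tc flip_neq.
      by case=> [[i'|j]|[]]; rewrite /differ /= ?flip_differ ?eqxx.
    * exists (cst I s, flip (cst J t) j, s == t); first by rewrite caseII_l sc flip_neq.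
      by case=> [[i|j']|[]]; rewrite /differ /= ?flip_differ ?eqxx.
    exists (cst I s, cst J t, ~~ (s == t)); first by rewrite caseII_l sNc cst_neqN.
    by case=> [[i|j]|[]]; rewrite /differ /= ?eqxx //; case: (s == t).
  + by move=> k; rewrite inE.
  move=> x xS; left.
  have [/existsP[w xw]|] := boolP [exists w, differ coord u x w].
    by exists (Some w); [exact: imset_f|move=> w' [->]].
  rewrite negb_exists => /forallP xu; move: uS; rewrite (_ : u = x) ?xS //.
  by apply: coord_inj => w; have := xu w; rewrite negbK => /eqP.
case: u uS noc => [[a b] c] uS noc.
have na s : a != cst I s.
  apply: contra noc => /eqP as_; move: uS;
    rewrite as_ caseII_l negb_or negbK => /andP[/eqP bs _].
  apply/existsP; exists (s, s == c); rewrite /= bs; apply/eqP; congr (_, _, _).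
  by case: (s) (c) => [] [].
have nb t : b != cst J t.
  apply: contra noc => /eqP bt; move: uS;
    rewrite bt caseII_r negb_or negbK => /andP[/eqP as_ _].
  apply/existsP; exists (t == c, t); rewrite /= as_; apply/eqP; congr (_, _, _).
  by case: (t) (c) => [] [].
(* With [B] empty, the colour [k0] keeps the last coordinate out of all classes in use. *)
exists (bool + bool + unit)%type, (fun w => match w with
  | inl (inl i) => inl (inl (i \in a)) | inl (inr j) => inl (inr (j \in b))
    | inr _ => inr tt end),
  (inr tt), [set inl k | k : bool + bool], set0; split.
+ by apply/pred0P=> k /=; apply/negP=> /andP[/imsetP[s _ ->]]; rewrite !inE.
+ move=> _ /imsetP[[s|s] _ ->].
    exists (cst I (~~ s), b, c); first by rewrite caseII_l nb.
    case=> [[i|j]|[]]; rewrite /differ /= ?in_cst ?eqxx //.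
    by case: (i \in a); case: (s).
  exists (a, cst J (~~ s), c); first by rewrite caseII_r na.
  case=> [[i|j]|[]]; rewrite /differ /= ?in_cst ?eqxx //.
  by case: (j \in b); case: (s).
+ by move=> k; rewrite inE.
move=> [[a' b'] c'] xS; left; have [[s as_]|[s bs]] := caseII_cst xS.
  exists (inl (inl (~~ s))); first exact: imset_f.
  by case=> [[i|j]|[]] // [] is_; rewrite /differ /= as_ in_cst is_; case: (s).
exists (inl (inr (~~ s))); first exact: imset_f.
by case=> [[i|j]|[]] // [] js; rewrite /differ /= bs in_cst js; case: (s).
Qed.

End CaseII.

(** * Translation of the given edge families into sets of points *)

Section Encoding.
Variables p q : nat.
Hypotheses (p0 : 0 < #|'I_p|) (q0 : 0 < #|'I_q|).
Implicit Types (x : point 'I_p 'I_q) (v : vertex p q).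

Definition vedge x : {set vertex p q} := point_edge coord x.

Definition antipode x : point 'I_p 'I_q := (~: x.1.1, ~: x.1.2, ~~ x.2).

(** The four points that the starred [Fpq] contributes, as [star_Fpq] shows. *)
Definition corner (s t : bool) : point 'I_p 'I_q := (cst 'I_p s, cst 'I_q t, s == t).

Let noF : bool -> bool -> bool := fun _ _ => false.

Lemma starK : involutive (@star p q).
Proof. by case=> w t; rewrite /star /= negbK. Qed.

Lemma in_star (A : {set vertex p q}) v : (v \in star_set A) = (star v \in A).
Proof.
apply/imsetP/idP=> [[w wA ->]|vA]; first by rewrite starK.
by exists (star v); rewrite ?starK.
Qed.

Lemma vedge_inj : injective vedge.
Proof.
move=> x y xy; apply: coord_inj => w.
have : ((w, coord x w) : vertex p q) \in vedge x by rewrite inE.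
by rewrite xy inE => /eqP.
Qed.

Lemma star_vedge x : star_set (vedge x) = vedge (antipode x).
Proof.
apply/setP=> -[w t]; rewrite in_star !inE /=.
case: w => [[i|j]|[]] /=; rewrite ?inE.
- by case: t; case: (i \in x.1.1).
- by case: t; case: (j \in x.1.2).
by case: t; case: x.2.
Qed.

Lemma antipodeK : involutive antipode.
Proof. by case=> [[a b] c]; rewrite /antipode /= !setCK negbK. Qed.

Lemma setC_cst (T : finType) s : ~: cst T s = cst T (~~ s).
Proof. by apply/setP=> i; rewrite inE !in_cst. Qed.

Lemma antipode_corner s t : antipode (corner s t)
  = (cst 'I_p (~~ s), cst 'I_q (~~ t), s != t).
Proof. by rewrite /antipode /= !setC_cst. Qed.

(** [a] lists the starred indices, so its complement gives the vertices left unstarred. *)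
Definition unstar_l (a : {set 'I_p}) : {set vertex p q} :=
  [set (inl (inl i), false) | i in ~: a].
Definition unstar_r (b : {set 'I_q}) : {set vertex p q} :=
  [set (inl (inr j), false) | j in ~: b].

Lemma in_unstar_l a v :
  (v \in unstar_l a) = if v is (inl (inl i), false) then i \notin a else false.
Proof.
apply/imsetP/idP=> [[i + ->]|]; first by rewrite inE.
by case: v => [[[i|j]|[]] []] // ia; exists i; rewrite ?inE.
Qed.

Lemma in_unstar_r b v :
  (v \in unstar_r b) = if v is (inl (inr j), false) then j \notin b else false.
Proof.
apply/imsetP/idP=> [[i + ->]|]; first by rewrite inE.
by case: v => [[[i|j]|[]] []] // ia; exists j; rewrite ?inE.
Qed.

Lemma P_unstar : P p q = unstar_l set0.
Proof. by rewrite /unstar_l setC0; apply/setP=> v; apply/imsetP/imsetP=> -[i _ ->];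
  exists i; rewrite ?inE. Qed.

Lemma Q_unstar : Q p q = unstar_r set0.
Proof. by rewrite /unstar_r setC0; apply/setP=> v; apply/imsetP/imsetP=> -[i _ ->];
  exists i; rewrite ?inE. Qed.

Lemma unstar_lD a : P p q :\: unstar_l a = unstar_l (~: a).
Proof.
apply/setP=> v; rewrite P_unstar in_setD !in_unstar_l.
by case: v => [[[i|j]|[]] []]; rewrite ?inE ?andbF ?andbT.
Qed.

Lemma unstar_rD b : Q p q :\: unstar_r b = unstar_r (~: b).
Proof.
apply/setP=> v; rewrite Q_unstar in_setD !in_unstar_r.
by case: v => [[[i|j]|[]] []]; rewrite ?inE ?andbF ?andbT.
Qed.

Lemma subset_P (A : {set vertex p q}) : A \in powerset (P p q)
  -> exists a, A = unstar_l a.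
Proof.
rewrite powersetE => /subsetP AP; exists [set i | (inl (inl i), false) \notin A].
apply/setP=> v; rewrite in_unstar_l; case: v (AP v) => [[[i|j]|[]] []];
  rewrite ?inE ?negbK // P_unstar in_unstar_l => H; by apply/negbTE/negP=> /H.
Qed.

Lemma subset_Q (B : {set vertex p q}) : B \in powerset (Q p q)
  -> exists b, B = unstar_r b.
Proof.
rewrite powersetE => /subsetP BQ; exists [set j | (inl (inr j), false) \notin B].
apply/setP=> v; rewrite in_unstar_r; case: v (BQ v) => [[[i|j]|[]] []];
  rewrite ?inE ?negbK // Q_unstar in_unstar_r => H; by apply/negbTE/negP=> /H.
Qed.

Lemma unstar_l_powerset a : unstar_l a \in powerset (P p q).
Proof.
rewrite powersetE P_unstar; apply/subsetP=> v; rewrite !in_unstar_l.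
by case: v => [[[i|j]|[]] []]; rewrite ?inE.
Qed.

Lemma unstar_r_powerset b : unstar_r b \in powerset (Q p q).
Proof.
rewrite powersetE Q_unstar; apply/subsetP=> v; rewrite !in_unstar_r.
by case: v => [[[i|j]|[]] []]; rewrite ?inE.
Qed.

Lemma unstar_l_neq0 a : (unstar_l a != set0) = (a != setT).
Proof. by rewrite /unstar_l imset_eq0 -setCT (inj_eq (@setC_inj _)). Qed.

Lemma unstar_r_neq0 b : (unstar_r b != set0) = (b != setT).
Proof. by rewrite /unstar_r imset_eq0 -setCT (inj_eq (@setC_inj _)). Qed.

Lemma unstar_lT : unstar_l setT = set0.
Proof. by apply/eqP; rewrite -[_ == _]negbK unstar_l_neq0 eqxx. Qed.

Lemma unstar_rT : unstar_r setT = set0.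
Proof. by apply/eqP; rewrite -[_ == _]negbK unstar_r_neq0 eqxx. Qed.

Lemma star_set0 : star_set set0 = set0 :> {set vertex p q}.
Proof. exact: imset0. Qed.

Lemma vedge_union a b c :
  vedge (a, b, c) = unstar_l a :|: star_set (unstar_l (~: a)) :|: unstar_r b
    :|: star_set (unstar_r (~: b)) :|: [set (inr tt, c)].
Proof.
apply/setP=> v; rewrite !in_setU !in_star in_unstar_l in_unstar_l in_unstar_r in_unstar_r !inE.
by case: v => [[[i|j]|[]] []]; rewrite /star /= ?inE ?negbK ?orbF ?orbT //; case: c.
Qed.

(** The four edge families are the cubes with [b] empty or full in layer [false], and [a] empty or
    full in layer [true]; requiring [P1] or [Q1] to be nonempty removes one corner from each. *)
Lemma Epq_caseI : Epq p q = [set vedge x | x in caseI noF].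
Proof.
have E1 a : vedge (a, set0, false) =
    unstar_l a :|: star_set (P p q :\: unstar_l a) :|: Q p q :|: [set r p q].
  by rewrite vedge_union unstar_lD Q_unstar setC0 unstar_rT star_set0 setU0.
have E2 a : vedge (a, setT, false) =
    (P p q :\: unstar_l (~: a)) :|: star_set (unstar_l (~: a)) :|: star_set (Q p q) :|:
      [set r p q].
  by rewrite vedge_union unstar_lD setCK Q_unstar setCT unstar_rT setU0.
have E3 b : vedge (set0, b, true) =
    P p q :|: (Q p q :\: unstar_r (~: b)) :|: star_set (unstar_r (~: b)) :|:
      [set star (r p q)].
  by rewrite vedge_union unstar_rD setCK P_unstar setC0 unstar_lT star_set0 setU0.
have E4 b : vedge (setT, b, true) =
    star_set (P p q) :|: unstar_r b :|: star_set (Q p q :\: unstar_r b) :|: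
      [set star (r p q)].
  by rewrite vedge_union unstar_rD P_unstar setCT unstar_lT set0U.
apply/setP=> e; apply/idP/imsetP.
  rewrite !inE => /orP[/orP[/orP[]|]|] /imsetP[X].
  - rewrite inE => /andP[/subset_P[a ->]]; rewrite unstar_l_neq0 -E1 => aT ->.
    exists (a, set0, false) => //; apply/existsP; exists false.
    by rewrite /= eqxx aT.
  - rewrite inE => /andP[/subset_P[a ->]]; rewrite unstar_l_neq0 -[a]setCK -E2 => aT ->.
    exists (~: a, setT, false) => //; apply/existsP; exists true.
    by rewrite /= eqxx orbF -setCT (inj_eq (@setC_inj _)) -[a]setCK.
  - rewrite inE => /andP[/subset_Q[b ->]]; rewrite unstar_r_neq0 -[b]setCK -E3 => bT ->.
    exists (set0, ~: b, true) => //; apply/existsP; exists false.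
    by rewrite /= eqxx orbF -setCT (inj_eq (@setC_inj _)) -[b]setCK.
  - rewrite inE => /andP[/subset_Q[b ->]]; rewrite unstar_r_neq0 -E4 => bT ->.
    exists (setT, b, true) => //; apply/existsP; exists true.
    by rewrite /= eqxx bT.
have memC (T : finType) (A : {set T}) : (~: A != setT) = (A != set0).
  by rewrite -[in RHS](inj_eq (@setC_inj _)) setC0.
move=> [[[a b] []]] /existsP[s /= /andP[/eqP->]]; rewrite orbF; case: s => /= H ->.
- rewrite E4 !inE; apply/orP; right; apply/imsetP; exists (unstar_r b) => //.
  by rewrite inE unstar_r_powerset unstar_r_neq0.
- rewrite E3 !inE; apply/orP; left; apply/orP; right; apply/imsetP;
    exists (unstar_r (~: b)) => //.
  by rewrite inE unstar_r_powerset unstar_r_neq0 memC.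
- rewrite E2 !inE; do 2!(apply/orP; left); apply/orP; right.
  apply/imsetP; exists (unstar_l (~: a)) => //.
  by rewrite inE unstar_l_powerset unstar_l_neq0 memC.
rewrite E1 !inE; do 3!(apply/orP; left); apply/imsetP; exists (unstar_l a) => //.
by rewrite inE unstar_l_powerset unstar_l_neq0.
Qed.

(** Each member of [Fpq] comes from the antipode of a corner, and starring undoes the antipode. *)
Lemma star_Fpq e : reflect (exists s t, e = vedge (corner s t))
  (e \in star_family (Fpq p q)).
Proof.
have F1 : P p q :|: Q p q :|: [set r p q] = vedge (antipode (corner true true)).
  by rewrite antipode_corner vedge_union P_unstar Q_unstar /=
    !setC0 ?unstar_lT ?unstar_rT ?star_set0 !setU0.
have F2 : star_set (P p q) :|: star_set (Q p q) :|:
  [set r p q] = vedge (antipode (corner false false)).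
  by rewrite antipode_corner vedge_union P_unstar Q_unstar /=
    !setCT ?unstar_lT ?unstar_rT set0U setU0.
have F3 : P p q :|: star_set (Q p q) :|: [set star (r p q)] = vedge (antipode (corner true false)).
  by rewrite antipode_corner vedge_union P_unstar Q_unstar /=
    !setCT !setC0 ?unstar_lT ?unstar_rT ?star_set0 !setU0.
have F4 : star_set (P p q) :|: Q p q :|: [set star (r p q)] = vedge (antipode (corner false true)).
  by rewrite antipode_corner vedge_union P_unstar Q_unstar /=
    !setCT !setC0 ?unstar_lT ?unstar_rT ?star_set0 set0U setU0.
rewrite /star_family /Fpq F1 F2 F3 F4.
apply: (iffP imsetP) => [[f]|[s [t ->]]].
  by rewrite !inE => /orP[/orP[/orP[]|]|] /eqP-> ->; rewrite star_vedge antipodeK;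
    [exists true, true|exists false, false|exists true, false|exists false, true].
exists (vedge (antipode (corner s t))); last by rewrite star_vedge antipodeK.
by rewrite !inE; case: s; case: t; rewrite eqxx ?orbT.
Qed.

Lemma caseI_kappa kappa x :
  caseI kappa x = caseI noF x || [exists s, [exists t, (x == corner s t) && kappa s t]].
Proof.
apply/idP/orP.
  case: x => [[a b] []] /existsP[s /= /andP[/eqP-> /orP[H|H]]].
  - by left; apply/existsP; exists s; rewrite /= eqxx H.
  - case: (eqVneq b (cst 'I_q s)) => [->|bs]; last by left; apply/existsP; exists s;
      rewrite /= eqxx bs.
    by right; apply/existsP; exists s; apply/existsP; exists s; rewrite H /corner !eqxx.
  - by left; apply/existsP; exists s; rewrite /= eqxx H.
  case: (eqVneq a (cst 'I_p (~~ s))) => [->|as_]; last by left; apply/existsP; exists s;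
    rewrite /= eqxx as_.
  right; apply/existsP; exists (~~ s); apply/existsP; exists s; rewrite H andbT /corner.
  by case: (s).
case=> [|/existsP[s /existsP[t /andP[/eqP-> k]]]].
  case: x => [[a b] []] /existsP[s /= /andP[/eqP->]]; rewrite orbF => H;
    by apply/existsP; exists s; rewrite /= eqxx H.
rewrite /corner; case: (eqVneq s t) => [st|st]; first by subst t;
  rewrite caseI_true // k orbT.
have sE : s = ~~ t by case: (s) (t) st => [] [].
by subst s; rewrite caseI_false // k orbT.
Qed.

Definition has_cst x : Prop := (exists s, x.1.1 = cst 'I_p s)
  \/ (exists t, x.1.2 = cst 'I_q t).

Lemma caseI_has_cst kappa x : caseI kappa x -> has_cst x.
Proof.
by case: x => [[a b] []] /existsP[s /andP[/eqP/= e _]]; [left|right]; exists s.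
Qed.

Lemma antipode_has_cst x : has_cst (antipode x) -> has_cst x.
Proof.
by case: x => [[a b] c] [[s /= e]|[t /= e]]; [left; exists (~~ s)|right; exists (~~ t)];
  rewrite -setC_cst -e setCK.
Qed.

(** The reason why [Epq] and its starred family together give all points with a constant entry: the
    antipode changes the layer, and a missing corner has its antipode in the family. *)
Lemma has_cst_caseI x : has_cst x -> caseI noF x || caseI noF (antipode x).
Proof.
case: x => [[a b] c] [[s /= ->]|[t /= ->]]; rewrite /antipode /= setC_cst; case: c => /=.
- rewrite caseI_true // orbF; case: eqVneq => //= ->.
  by rewrite setC_cst caseI_false // orbF negbK cst_Nneq.
- rewrite caseI_true // orbF; case: (eqVneq b (cst 'I_q s)) => [->|bs].
    by rewrite caseI_false // cst_neqN.
  suff -> : ~: b != cst 'I_q (~~ s) by rewrite orbT.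
  by rewrite -setC_cst (inj_eq (@setC_inj _)).
- rewrite orbC caseI_false // orbF negbK; case: (eqVneq a (cst 'I_p (~~ t))) => [->|at_].
    by rewrite orbC caseI_true // cst_neqN.
  suff -> : ~: a != cst 'I_p t by [].
  by rewrite -[t]negbK -setC_cst (inj_eq (@setC_inj _)).
- rewrite caseI_false // orbF; case: eqVneq => //= ->.
  by rewrite setC_cst negbK caseI_true // cst_Nneq.
Qed.

Lemma caseI_corner s t : caseI noF (corner s t) = false.
Proof.
rewrite /corner; case: (eqVneq s t) => [<-|st]; first by rewrite caseI_true // eqxx.
have -> : s = ~~ t by case: (s) (t) st => [] [].
by rewrite caseI_false // eqxx.
Qed.

Lemma caseII_corner kappa x :
  caseII kappa x <-> has_cst x /\ forall s t, x = corner s t -> kappa s t.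
Proof.
have scs s c : c = (s == (s == c)) by case: s; case: c.
have scs' s c : c = ((s == c) == s) by case: s; case: c.
split=> [xS|[]].
  split; first by case: x xS => [[a b] c] /caseII_cst.
  move=> s t xE; move: xS; rewrite xE /corner caseII_l //.
  have -> : (s == (s == t)) = t by case: (s) (t) => [] [].
  by rewrite eqxx.
case: x => [[a b] c] [[s /= ->]|[t /= ->]] k.
  rewrite caseII_l //; case: eqVneq => //= bs; apply: k.
  by rewrite /corner bs -scs.
rewrite caseII_r //; case: eqVneq => //= as_; apply: k.
by rewrite /corner as_ -scs'.
Qed.

Lemma antipode_corner_Fpq (F' : {set {set vertex p q}}) x :
    F' \subset Fpq p q -> vedge (antipode x) \in F' -> exists s t, x = corner s t.
Proof.
move=> /subsetP F'F /F'F xF; have /star_Fpq[s [t]] : star_set (vedge (antipode x))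
  \in star_family (Fpq p q).
  exact: imset_f.
by rewrite star_vedge antipodeK => /vedge_inj ->; exists s, t.
Qed.

Lemma in_predE (T : Type) (S : pred T) (y : T) : (y \in S) = S y.
Proof. by []. Qed.

Lemma edges_caseI (F : {set {set vertex p q}}) : F \subset star_family (Fpq p q) ->
  Epq p q :|: F = [set vedge x | x in caseI (fun s t => vedge (corner s t) \in F)].
Proof.
move=> /subsetP FF; apply/setP=> e; rewrite Epq_caseI in_setU; apply/orP/imsetP.
  case=> [/imsetP[x xS ->]|eF]; first by exists x; rewrite // in_predE caseI_kappa;
    apply/orP; left.
  have /star_Fpq[s [t eE]] := FF e eF; exists (corner s t) => //.
  rewrite in_predE caseI_kappa; apply/orP; right.
  by apply/existsP; exists s; apply/existsP; exists t; rewrite eqxx -eE.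
move=> [x + ->]; rewrite in_predE caseI_kappa => /orP[xS|/existsP[s /existsP[t /andP[/eqP-> k]]]].
  by left; apply: imset_f.
by right.
Qed.

(** [F'] contains only antipodes of corners, so omitting it loses only corners, and [Epq] supplies
    none of these. *)
Lemma edges_caseII (F' : {set {set vertex p q}}) : F' \subset Fpq p q ->
  Epq p q :|: star_family (Epq p q :\: F') =
  [set vedge x | x in caseII (fun s t => vedge (antipode (corner s t)) \notin F')].
Proof.
move=> F'F; apply/setP=> e; rewrite Epq_caseI in_setU; apply/orP/imsetP.
  case=> [/imsetP[x xS ->]|/imsetP[e' /setDP[/imsetP[x xS ->] eF'] ->]].
    exists x; rewrite // in_predE; apply/caseII_corner; split;
      first exact: caseI_has_cst xS.
    by move=> s t xE; move: xS; rewrite in_predE xE caseI_corner.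
  exists (antipode x); last exact: star_vedge.
  rewrite in_predE; apply/caseII_corner; split.
    by apply: antipode_has_cst; rewrite antipodeK; apply: caseI_has_cst xS.
  by move=> s t <-; rewrite antipodeK.
move=> [x + ->]; rewrite in_predE => /caseII_corner[xc k].
case/orP: (has_cst_caseI xc) => xS; first by left; apply: imset_f.
right; apply/imsetP; exists (vedge (antipode x)); last by rewrite star_vedge antipodeK.
rewrite in_setD imset_f // andbT; apply/negP=> xF'.
have [s [t xE]] := antipode_corner_Fpq F'F xF'.
by have := k s t xE; rewrite -xE xF'.
Qed.

End Encoding.

(** * Assembly of the two cases *)

Lemma polar_ext (W X : finType) (coord : X -> W -> bool) (S S' : pred X) :
  S =1 S' -> polar coord S -> polar coord S'.
Proof.
move=> SS [x [y [Sx Sy xy]]]; exists x, y; rewrite -!SS; split=> // z w.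
by rewrite -SS; apply: xy.
Qed.

Theorem theorem4p2 (p q : nat) (hp : 1 < p) (hq : 1 < q)
    (F : {set {set vertex p q}}) :
  (F \subset star_family (Fpq p q) /\ F <> set0) \/
  (exists F' : {set {set vertex p q}},
     [/\ F' \subset Fpq p q, F' <> set0 & F = star_family (Epq p q :\: F')]) ->
  packing_property (QpqF F).
Proof.
have p0 : 0 < #|'I_p| by rewrite card_ord ltnW.
have q0 : 0 < #|'I_q| by rewrite card_ord ltnW.
have q1 : 1 < #|'I_q| by rewrite card_ord.
case=> [[FF /eqP/set0Pn[e eF]]|[F' [F'F _ ->]]].
  apply: (@cuboid_packing _ _ coord _ (@coord_full _ _) (QpqF F) (edges_caseI p0 q0 FF)).
    (* Disjointness from [D] is traded for membership in a face, the setting of the polarity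
       lemmas. *)
    move=> D [x xS xD]; apply: (polar_ext (fun y => congr1 (andb _)
      (esym (disjoint_faceP D y)))).
    apply: (polar_caseI p0 q0 _ (x := x)); rewrite -?disjoint_faceP ?xS //.
    (* Any member of [F] is a corner retained by [kappa]. *)
    have /star_Fpq[s [t eE]] := subsetP FF e eF.
    by exists s, t; rewrite -eE.
  exact: fan_caseI.
apply: (@cuboid_packing _ _ coord _ (@coord_full _ _) (QpqF _) (edges_caseII p0 q0 F'F)).
  move=> D [x xS xD]; apply: (polar_ext (fun y => congr1 (andb _)
    (esym (disjoint_faceP D y)))).
  by apply: (polar_caseII p0 q0 q1 (x := x)); rewrite // -?disjoint_faceP ?xS.
exact: fan_caseII.
Qed.
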